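(* Let $r\ge2$ and let $\mathbf{k}=(k_1,\dots,k_r)\in\mathbb{N}_0^r$ with $k_1\ge k_2\ge\dots\ge k_r=0$; write $\mathbf{k}'=(k_2,\dots,k_r)$ and let $j\in\{2,\dots,r\}$ be maximal with $k_j=k_2$. Let $c(\mathbf{k}')=|d_{\mathbf u_0}(\boldsymbol\omega')|$ for $\boldsymbol\omega'\in\mathbf F'_{\mathbf k'}$, where $\mathbf u_0=(T^{-1},0,\dots,0)\in(K/A)^{r-1}$ (this value does not depend on the choice of $\boldsymbol\omega'\in\mathbf F'_{\mathbf k'}$). (i) For all $k\ge0$ and all $\boldsymbol\omega'\in\mathbf F'_{\mathbf k'}$, the coefficients of the product function $P(t)=\sum_{k\ge0}p_k(\boldsymbol\omega')t^k$ satisfy $|p_k(\boldsymbol\omega')|\le c(\mathbf k')^k$, with equality at least if $k$ is a sum of pairwise different numbers of the form $Q_d=q^{rd}-q^{rd-(j-1)}$ ($d\in\mathbb{N}$). (ii) The coefficients $a_k(\boldsymbol\omega')$ of $P(t)^{(q^r-1)(q-1)}=\sum_k a_kt^k$ and $b_k(\boldsymbol\omega')$ of $P(t)^{q^r-1}=\sum_kb_kt^k$ satisfy $|a_k|\le c(\mathbf k')^k$ and $|b_k|\le c(\mathbf k')^k$ on $\mathbf F'_{\mathbf k'}$.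
   Context: Let $A=\mathbb{F}_q[T]$, $K=\mathbb{F}_q(T)$, $K_\infty=\mathbb{F}_q((T^{-1}))$ with $|T|=q$, $C_\infty$ the completion of an algebraic closure of $K_\infty$. For a discrete $A$-lattice $\Lambda\subset C_\infty$, $e^\Lambda(z)=z\prod_{0\ne\lambda\in\Lambda}(1-z/\lambda)$. For $s\ge1$, $\Omega^s=\{\boldsymbol\omega=(\omega_1,\dots,\omega_{s-1},1)\in C_\infty^s:\ \omega_i\ K_\infty\text{-linearly independent}\}$ ($\Omega^1=\{1\}$), $\Lambda_{\boldsymbol\omega}=\sum A\omega_i$. A finite set is orthogonal if $|\sum a_i\omega_i|=\max|a_i\omega_i|$ for all $a_i\in K_\infty$. Here $\Omega'=\Omega^{r-1}$ with points written $\boldsymbol\omega'=(\omega_2,\dots,\omega_r=1)$, and $\mathbf F'_{\mathbf k'}=\{\boldsymbol\omega'\in\Omega^{r-1}:\ \{\omega_2,\dots,\omega_r\}\text{ orthogonal},\ \log_q|\omega_i|=k_i\ (2\le i\le r)\}$. Division functions: for $\mathbf u\in(K/A)^{r-1}$, $d_{\mathbf u}(\boldsymbol\omega')=e^{\Lambda_{\boldsymbol\omega'}}(\mathbf u\boldsymbol\omega')$, where $\mathbf u\boldsymbol\omega'=\sum_i u_i\omega_{i+1}$ computed with any representative of $\mathbf u$ in $K^{r-1}$. For monic $n\in A$ of degree $d$ let $S_n(X)=\prod_{0\ne\mathbf u\in(n^{-1}A/A)^{r-1}}(1-d_{\mathbf u}(\boldsymbol\omega')X)$ (so $S_n=1$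 if $d=0$); for $d\ge1$, $S_n(X)-1$ only has monomials of degree $\ge q^{(r-1)d}-q^{(r-1)d-1}$. The product function is the formal power series $P(t)=\prod_{n\in A\text{ monic}}S_n(t)=\sum_{k\ge0}p_k(\boldsymbol\omega')t^k$, whose coefficients are functions on $\Omega^{r-1}$. *)

(* Defs.v *)
From HB Require Import structures.
From mathcomp Require Import all_boot all_order all_algebra finmap.
From mathcomp Require Import qpoly.
From mathcomp Require Import all_classical all_reals all_analysis.

Set Implicit Arguments.
Unset Strict Implicit.
Unset Printing Implicit Defensive.

Import Order.TTheory GRing.Theory Num.Theory.
Import numFieldNormedType.Exports.

#[global] Open Scope classical_set_scope.
#[global] Open Scope ring_scope.

(* A = {poly F} and K = {fraction {poly F}}, with F the field of q = #|F|
   elements. *)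
Notation fracA := (@FracField.tofrac _).

Section Cinfinity.
Context {R : realType} {F : finFieldType} {C : closedFieldType}.
Variables (iota : {rmorphism {fraction {poly F}} -> C}) (abs : C -> R).

Definition clim (x : nat -> C) (l : C) : Prop :=
  abs (x n - l) @[n --> \oo] --> (0 : R).

Definition ccauchy (x : nat -> C) : Prop :=
  forall e : R, 0 < e ->
    exists N, forall m n, (N <= m)%N -> (N <= n)%N -> abs (x m - x n) < e.

(* K_oo = F((1/T)) inside C: the sums of the convergent Laurent series
   T^N * (a_0 + a_1 T^-1 + a_2 T^-2 + ...). *)
Definition Kinf : set C := [set x | exists (N : nat) (a : nat -> F),
  clim (fun n => \sum_(i < n)
          iota (fracA (a i)%:P * (fracA 'X) ^+ N / (fracA 'X) ^+ i)) x].

Definition algebraic_over_Kinf (y : C) : Prop :=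
  exists p : {poly C}, [/\ p != 0, forall i, Kinf p`_i & root p y].

(* These properties determine (C, iota, abs) up to isomorphism: the elements of
   C algebraic over K_oo form an algebraic closure of K_oo, the absolute value
   on it is the unique extension of the one of K_oo with |T| = q, and C, being
   complete, is its completion. *)
Record is_Cinf : Prop := IsCinf {
  abs_ge0 : forall x, 0 <= abs x;
  abs_eq0 : forall x, abs x = 0 <-> x = 0;
  absM : forall x y, abs (x * y) = abs x * abs y;
  absD_ultra : forall x y, abs (x + y) <= Num.max (abs x) (abs y);
  abs_T : abs (iota (fracA 'X)) = #|F|%:R;
  C_complete : forall x, ccauchy x -> exists l, clim x l;
  C_dense : forall x (e : R), 0 < e ->
    exists2 y, algebraic_over_Kinf y & abs (x - y) < e
}.

(* Value of the unconditionally convergent product of the f x, x in S: limit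
   along the directed set of finite subsets of S. *)
Definition is_cprod (S : set C) (f : C -> C) (l : C) : Prop :=
  forall e : R, 0 < e -> exists2 s0 : {fset C}, [set` s0] `<=` S &
    forall s : {fset C}, [set` s0] `<=` [set` s] -> [set` s] `<=` S ->
      abs (\prod_(x <- s) f x - l) < e.

Definition cprod (S : set C) (f : C -> C) : C := xget 0 (is_cprod S f).

Definition lattice_exp (L : set C) (z : C) : C :=
  z * cprod [set l | L l /\ l <> 0] (fun l => 1 - z / l).

Section Points.
Variable s : nat.
Implicit Types (w : 'I_s -> C) (u : 'I_s -> {fraction {poly F}}).

Definition Kinf_independent w : Prop :=
  forall a : 'I_s -> C, (forall i, Kinf (a i)) ->
    \sum_i a i * w i = 0 -> forall i, a i = 0.

Definition orthogonal w : Prop :=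
  forall a : 'I_s -> C, (forall i, Kinf (a i)) ->
    abs (\sum_i a i * w i) = \big[Num.max/0]_i abs (a i * w i).

Definition Omega : set ('I_s -> C) :=
  [set w | (forall i : 'I_s, i.+1 = s -> w i = 1) /\ Kinf_independent w].

Definition lattice w : set C :=
  [set l | exists a : 'I_s -> {poly F}, l = \sum_i iota (fracA (a i)) * w i].

Definition logq (x : R) : R := ln x / ln #|F|%:R.

Definition Fdom (k : 'I_s -> nat) : set ('I_s -> C) :=
  [set w | [/\ Omega w, orthogonal w & forall i, logq (abs (w i)) = (k i)%:R]].

(* u is a representative in K^s of a class in (K/A)^s. *)
Definition division_fun u w : C :=
  lattice_exp (lattice w) (\sum_i iota (u i) * w i).

(* (n^-1 A / A)^s, for n of degree d, is indexed by the numerators a of the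
   unique representatives a/n with deg a < d. *)
Definition S_poly (n : {poly F}) w : {poly C} :=
  \prod_(a : {ffun 'I_s -> {poly_(size n).-1 F}} | a != [ffun => 0])
    (1 - division_fun (fun i => fracA (a i : {poly F}) / fracA n) w *: 'X).

(* Coefficientwise limit of the finite products of the S_n, along the finite
   sets of monic polynomials. *)
Definition is_product_coef w (k : nat) (c : C) : Prop :=
  exists2 s0 : {fset {poly F}}, (forall n, n \in s0 -> n \is monic) &
    forall t : {fset {poly F}}, [set` s0] `<=` [set` t] ->
      (forall n, n \in t -> n \is monic) ->
      (\prod_(n <- t) S_poly n w)`_k = c.

Definition product_coef w (k : nat) : C := xget 0 (is_product_coef w k).

End Points.

(* Formal power series over C are given by their coefficients. *)
Definition fps_mul (f g : nat -> C) (k : nat) : C :=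
  \sum_(i < k.+1) f i * g (k - i)%N.

Definition fps_exp (f : nat -> C) (m : nat) : nat -> C :=
  iter m (fps_mul f) (fun k => (k == 0%N)%:R).

End Cinfinity.

Definition u0 (F : finFieldType) (s : nat) (i : 'I_s) : {fraction {poly F}} :=
  if i == 0%N :> nat then (fracA 'X)^-1 else 0.

Definition Qnum (q r j d : nat) : nat := (q ^ (r * d) - q ^ (r * d - (j - 1)))%N.

Definition sum_of_distinct_Q (q r j k : nat) : Prop :=
  exists E : seq nat, [/\ uniq E,
    forall m, m \in E -> exists2 d, (0 < d)%N & m = Qnum q r j d
    & k = sumn E].

Lemma reduced_representative (F : finFieldType) (n a : {poly F}) :
  n \is monic ->
  exists! b : {poly_(size n).-1 F}, exists c : {poly F},
    fracA a / fracA n = fracA (b : {poly F}) / fracA n + fracA c.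
Proof.
move=> nm; have n0 : n != 0 by exact: monic_neq0.
have fn0 : fracA n != 0 by rewrite tofrac_eq0.
have sn (b : {poly F}) : (size b < size n)%N = (size b <= (size n).-1)%N.
  by rewrite -[in RHS]ltnS prednK // size_poly_gt0.
have sb : (size (a %% n)%R <= (size n).-1)%N by rewrite -sn ltn_modp.
exists (NPoly sb); split.
  exists (a %/ n); rewrite {1}(divp_eq a n) /= tofracD tofracM mulrDl mulfK //.
  exact: addrC.
move=> b [c] /(congr1 (fun x => x * fracA n)).
rewrite mulrDl !divfK // -tofracM -tofracD => /eqP; rewrite tofrac_eq => /eqP ab.
apply/val_inj => /=; rewrite ab addrC modp_addl_mul_small //.
by rewrite sn size_npoly.
Qed.

(* Main.v *)
(* Write q for the cardinality of F, s = r - 1 and m = j - 1. By orthogonality,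
   for z in K^s w with coordinates of absolute value < 1 one has
   |z - l| = max(|z|, |l|) for every lattice point l; hence |e(z)| is a strictly
   increasing function of |z|, and |d_u| <= c, with equality exactly if some
   u_i with i < m satisfies |u_i| = 1/q. By additivity of e, the class of d_u
   modulo elements of absolute value < c depends only on the coefficients of
   1/T in the u_i, i < m. So, after reduction in the variable t / c, the product
   of the S_n over all monic n of degree d becomes the power of exponent
   q^(rd - m) of one polynomial B of degree q^m - 1, which is a polynomial in
   t^(q^(rd - m)). As m < r, expansions in base q^r are unique, and for k a sum
   of distinct Q_d = (q^m - 1) q^(rd - m) exactly one product of monomials
   contributes to the coefficient of t^k. The product P exists because the
   polynomial with roots an F-subspace of C is F-linearized, so S_n - 1 has only
   terms of high degree. *)
Require Import Defs.
From mathcomp Require Import all_boot all_order all_algebra.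
From mathcomp Require Import fingroup pgroup abelian finfield finmap qpoly zify ring lra.
From mathcomp Require Import all_classical all_reals all_analysis.
Import Order.TTheory GRing.Theory Num.Theory.
Import numFieldNormedType.Exports.

Set Implicit Arguments.
Unset Strict Implicit.
Unset Printing Implicit Defensive.
Local Open Scope classical_set_scope.
Local Open Scope ring_scope.

(** * Linearized polynomials and q-power maps *)

Section FrobeniusPower.
Context {F : finFieldType} {C : fieldType}.
Variable kap : {rmorphism F -> C}.
(* Occurrences of [#|F|] may differ in the inferred finType structure, whence
   the name [q] for it. *)
Variable q : nat.
Hypothesis qE : #|F| = q.

Lemma q_gt1 : (1 < q)%N.
Proof. by rewrite -qE finNzRing_gt1. Qed.

(** Through [kap] the fields F and C have the same characteristic, and q is a power of it because
    the additive group of F is elementary abelian. *)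
Lemma card_pnat_pchar (e : nat) : [pchar C].-nat (q ^ e)%N.
Proof.
have [p p_pr pF] := finPcharP F.
have pC : p \in [pchar C] by exact: (rmorph_pchar kap).
have := abelem_pgroup (fin_ring_pchar_abelem pF).
rewrite /pgroup cardsT qE pnatX => pF'; apply/orP; left.
by apply: sub_in_pnat pF' => p' _; rewrite inE => /eqP ->.
Qed.

Lemma card_pnat_pchar_poly (e : nat) : [pchar {poly C}].-nat (q ^ e)%N.
Proof. by rewrite (eq_pnat _ (pchar_poly C)) card_pnat_pchar. Qed.

Lemma exprD_card (e : nat) (x y : C) :
  (x + y) ^+ (q ^ e) = x ^+ (q ^ e) + y ^+ (q ^ e).
Proof. by rewrite exprDn_pchar ?card_pnat_pchar. Qed.

Lemma exprD_card_poly (e : nat) (x y : {poly C}) :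
  (x + y) ^+ (q ^ e) = x ^+ (q ^ e) + y ^+ (q ^ e).
Proof. by rewrite exprDn_pchar ?card_pnat_pchar_poly. Qed.

Lemma card_expn_gt0 (e : nat) : (0 < q ^ e)%N.
Proof. by rewrite expn_gt0 (ltn_trans _ q_gt1). Qed.

Lemma expr_sum_card_poly (e : nat) (I : Type) (s : seq I) (f : I -> {poly C}) :
  (\sum_(i <- s) f i) ^+ (q ^ e) = \sum_(i <- s) f i ^+ (q ^ e).
Proof.
apply: (big_morph (fun x : {poly C} => x ^+ (q ^ e)) (exprD_card_poly e)).
by rewrite expr0n -[X in X == _]prednK ?card_expn_gt0.
Qed.

Lemma kap_expr_card (e : nat) (c : F) : kap c ^+ (q ^ e) = kap c.
Proof.
elim: e => [|e IH]; first by rewrite expn0 expr1.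
by rewrite expnS mulnC exprM IH -rmorphXn -qE expf_card.
Qed.

(** The q-linearized polynomials of degree at most q^m, which act F-linearly on C. *)
Definition qlpoly (m : nat) (l : nat -> C) : {poly C} :=
  \sum_(i < m.+1) l i *: 'X^(q ^ i).

Lemma horner_qlpoly m l x : (qlpoly m l).[x] = \sum_(i < m.+1) l i * x ^+ (q ^ i).
Proof. by rewrite horner_sum; apply: eq_bigr => i _; rewrite hornerZ hornerXn. Qed.

Lemma horner_qlpolyD m l x y :
  (qlpoly m l).[x + y] = (qlpoly m l).[x] + (qlpoly m l).[y].
Proof.
rewrite !horner_qlpoly -big_split; apply: eq_bigr => i _ /=.
by rewrite exprD_card mulrDr.
Qed.

Lemma horner_qlpolyZ m l c x :
  (qlpoly m l).[kap c * x] = kap c * (qlpoly m l).[x].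
Proof.
rewrite !horner_qlpoly mulr_sumr; apply: eq_bigr => i _.
by rewrite exprMn kap_expr_card mulrCA.
Qed.

(** Additivity at the level of polynomials: it turns a product over a coset of an F-space into a
    linearized polynomial minus a constant. *)
Lemma comp_qlpoly_translate m l a :
  qlpoly m l \Po ('X - a%:P) = qlpoly m l - ((qlpoly m l).[a])%:P.
Proof.
rewrite -[a]opprK; move: (- a) => b.
have hN : (qlpoly m l).[- b] = - (qlpoly m l).[b].
  apply/eqP; rewrite -addr_eq0 -horner_qlpolyD addNr horner_qlpoly big1 // => i _.
  by rewrite expr0n -[X in X == _]prednK ?card_expn_gt0 // mulr0.
rewrite hN !polyCN !opprK horner_qlpoly rmorph_sum /= raddf_sum /= -big_split /=.
apply: eq_bigr => i _; rewrite comp_polyZ comp_Xn_poly exprD_card_poly.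
by rewrite scalerDr -polyC_exp; congr (_ + _); rewrite -mul_polyC -polyCM.
Qed.

(** The identity X^q - X = prod_c (X - c), homogenized in y and evaluated at E. *)
Lemma prod_sub_kap (E : {poly C}) (y : C) :
  \prod_(c : F) (E - (kap c * y)%:P) = E ^+ q - y ^+ q.-1 *: E.
Proof.
have q1 := q_gt1.
have [->|y0] := eqVneq y 0.
  under eq_bigr do rewrite mulr0 subr0.
  by rewrite prodr_const qE expr0n -[X in X == _]prednK ?scale0r ?subr0 // -subn1 subn_gt0.
have [D ED] : exists D, E = y *: D.
  by exists (y^-1 *: E); rewrite scalerA divff // scale1r.
have H : \prod_(c : F) (D - (kap c)%:P) = D ^+ q - D.
  have := congr1 (fun p => map_poly kap p \Po D) (finField_genPoly F).
  rewrite qE rmorphB /= map_polyXn map_polyX comp_polyB comp_Xn_poly comp_polyX => ->.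
  rewrite rmorph_prod /= rmorph_prod /=; apply: eq_bigr => c _.
  by rewrite map_polyXsubC rmorphB /= comp_polyX comp_polyC.
transitivity (\prod_(c : F) (y%:P * (D - (kap c)%:P))).
  by apply: eq_bigr => c _; rewrite {1}ED mulrBr -polyCM [y * _]mulrC mul_polyC.
rewrite big_split /= H prodr_const qE ED exprZn mulrBr -polyC_exp !mul_polyC scalerA.
by rewrite -exprSr prednK // ltnW.
Qed.

Lemma qlpolyX m l : qlpoly m l ^+ q =
  \sum_(i < m.+1) l i ^+ q *: 'X^(q ^ i.+1).
Proof.
rewrite -[X in _ ^+ X]expn1 expr_sum_card_poly expn1; apply: eq_bigr => i _.
by rewrite exprZn -exprM expnSr.
Qed.

(** Induction on m, splitting off one coordinate: if L is the polynomial of the remaining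
    coordinates and x the image of the first basis vector, the full product is prod_c (L - c L(x)) =
    L^q - L(x)^(q-1) L. Roots are counted with multiplicity, f being any F-linear map. *)
Lemma prod_linear_qlpoly m (f : 'rV[F]_m -> C) :
  (forall c u v, f (c *: u + v) = kap c * f u + f v) ->
  exists2 l : nat -> C, l m = 1 & \prod_v ('X - (f v)%:P) = qlpoly m l.
Proof.
elim: m f => [|m IH] f fL.
  exists (fun=> 1) => //; rewrite /qlpoly big_ord1 expn0 scale1r expr1.
  have f0 : f 0 = 0.
    by have := fL (-1) 0 0; rewrite scaler0 addr0 rmorphN1 mulN1r addNr.
  rewrite (bigD1 0) //= f0 subr0 big1 ?mulr1 // => v.
  by rewrite [v]thinmx0 eqxx.
pose g (v : 'rV[F]_m) := f (row_mx 0 v : 'rV_(1 + m)).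
have rowL c (a b : 'rV[F]_1) (u v : 'rV[F]_m) :
    row_mx (c *: a + b) (c *: u + v) = c *: row_mx a u + row_mx b v.
  by rewrite scale_row_mx add_row_mx.
have [c u v|l lm El] := IH g.
  rewrite /g -fL; congr (f _); apply: etrans (rowL _ _ _ _ _).
  by rewrite scaler0 addr0.
pose x := f (row_mx 1 0 : 'rV_(1 + m)).
have fE c v : f (row_mx c%:M v : 'rV_(1 + m)) = kap c * x + g v.
  rewrite -fL; congr (f _); apply: etrans (rowL _ _ _ _ _).
  by rewrite scaler0 add0r addr0 scale_scalar_mx mulr1.
pose h (p : F * 'rV[F]_m) : 'rV_(1 + m) := row_mx p.1%:M p.2.
have hbij : bijective h.
  exists (fun v : 'rV_(1 + m) => (lsubmx v 0 0, rsubmx v)) => [[c v]|v].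
    by rewrite /h /= row_mxKl row_mxKr mxE eqxx.
  by rewrite /h /= -mx11_scalar hsubmxK.
have -> : \prod_v ('X - (f v)%:P) = \prod_(c : F) \prod_v ('X - (kap c * x + g v)%:P).
  rewrite (reindex h) /=; last exact: onW_bij.
  by rewrite pair_big /=; apply: eq_bigr => -[c v] _; rewrite fE.
have Ec c : \prod_v ('X - (kap c * x + g v)%:P) = qlpoly m l - (kap c * (qlpoly m l).[x])%:P.
  rewrite -horner_qlpolyZ -comp_qlpoly_translate -El rmorph_prod; apply: eq_bigr => v _ /=.
  by rewrite comp_polyB comp_polyX comp_polyC polyCD opprD addrA.
rewrite (eq_bigr _ (fun c _ => Ec c)) prod_sub_kap qlpolyX.
set y := _ ^+ _.
(* The coefficients of L^q - y L: the power q shifts the indices by one, and [l] has to be cut off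
   beyond m. *)
exists (fun i => (if i is i'.+1 then l i' ^+ q else 0) - (if (i <= m)%N then y * l i else 0)).
  by rewrite /= lm expr1n ltnn subr0.
rewrite /qlpoly.
under [RHS]eq_bigr do rewrite scalerBl.
rewrite sumrB; congr (_ - _).
  by rewrite [RHS]big_ord_recl /= scale0r add0r.
rewrite [RHS]big_ord_recr /= ltnn scale0r addr0 scaler_sumr; apply: eq_bigr => i _.
by rewrite -(ltnS i) ltn_ord scalerA.
Qed.

Lemma size_prod_1subZX (s : seq C) :
  (size (\prod_(a <- s) (1 - a *: 'X))%R <= (size s).+1)%N.
Proof.
elim: s => [|a s IH]; first by rewrite big_nil size_poly1.
rewrite big_cons; apply: leq_trans (size_polyMleq _ _) _.
suff : (size (1 - a *: 'X)%R <= 2)%N 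
  by move=> h; rewrite -subn1 leq_subLR; apply: leq_trans (leq_add h IH) _.
apply: leq_trans (size_polyD _ _) _; rewrite geq_max size_poly1 size_polyN.
by apply: leq_trans (size_scale_leq _ _) _; rewrite size_polyX.
Qed.

(** Reciprocal polynomials: substituting 1/X in the product of the X - a and clearing denominators
    reverses the coefficients. *)
Lemma coef_prod_1subZX (s : seq C) k : (k <= size s)%N ->
  (\prod_(a <- s) (1 - a *: 'X))`_k = (\prod_(a <- s) ('X - a%:P))`_(size s - k).
Proof.
elim: s k => [|a s IH] k /=; first by rewrite leqn0 => /eqP ->; rewrite !big_nil.
have cL P i : ((1 - a *: 'X) * P)`_i = P`_i - a * (if i == 0%N then 0 else P`_i.-1).
  by rewrite mulrBl mul1r coefB -scalerAl coefZ ['X * P]mulrC coefMX.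
have cR P i : (('X - a%:P) * P)`_i = (if i == 0%N then 0 else P`_i.-1) - a * P`_i.
  by rewrite mulrBl coefB ['X * P]mulrC coefMX coefCM.
move=> ks; rewrite !big_cons cL cR.
case: k ks => [|k] ks.
  rewrite subn0 /= mulr0 subr0 IH // subn0.
  rewrite [X in _ = _ - _ * X]nth_default ?mulr0 ?subr0 //.
  by rewrite size_prod_XsubC.
rewrite subSS /= [X in _ - a * X]IH; last by rewrite -ltnS.
move: ks; rewrite ltnS leq_eqVlt => /orP[/eqP->|ks]; last first.
  by rewrite IH // subnS subn_eq0 leqNgt ks.
rewrite subnn eqxx [X in X - _]nth_default //.
exact: size_prod_1subZX.
Qed.

(** The exponents in the reciprocal of a linearized polynomial of degree q^m are the q^m - q^i, the
    smallest positive one being q^m - q^(m-1). *)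
Lemma coef_prod_linear_gap m (f : 'rV[F]_m -> C) k :
  (forall c u v, f (c *: u + v) = kap c * f u + f v) ->
  (0 < k)%N -> (k < q ^ m - q ^ m.-1)%N ->
  (\prod_v (1 - f v *: 'X))`_k = 0.
Proof.
move=> fL k0 km; have [l _ El] := prod_linear_qlpoly fL.
rewrite -(big_map f xpredT (fun a => 1 - a *: 'X)).
have sz : size [seq f v | v <- index_enum 'rV[F]_m] = (q ^ m)%N.
  by rewrite size_map -sum1_size (eq_bigl (mem 'rV[F]_m)) // sum1_card card_mx mul1n qE.
rewrite coef_prod_1subZX sz; last by rewrite (leq_trans (ltnW km)) // leq_subr.
rewrite big_map El coef_sum big1 // => i _; rewrite coefZ coefXn.
case: eqP => [e|_]; last by rewrite mulr0.
have [im|im] := eqVneq (i : nat) m; first by exfalso; rewrite im in e; lia.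
have : (q ^ i <= q ^ m.-1)%N.
  rewrite leq_exp2l ?q_gt1 //.
  by have := ltn_ord i; move/eqP: im; lia.
lia.
Qed.

Lemma expr_card_poly e (p : {poly C}) :
  p ^+ (q ^ e) = \sum_(i < size p) p`_i ^+ (q ^ e) *: 'X^(i * q ^ e).
Proof.
rewrite -{1}[p]coefK poly_def expr_sum_card_poly; apply: eq_bigr => i _.
by rewrite exprZn exprM.
Qed.

(** All exponents of p^(q^e) are multiples of q^e and g has degree below q^e, so uniqueness of
    Euclidean division leaves one contribution. *)
Lemma coefM_expr_card e (g p : {poly C}) k i :
  (size g <= q ^ e)%N -> (k < q ^ e)%N ->
  (g * p ^+ (q ^ e))`_(k + i * q ^ e) = g`_k * p`_i ^+ (q ^ e).
Proof.
move=> sg kq; rewrite expr_card_poly mulr_sumr coef_sum.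
under eq_bigr do rewrite -scalerAr coefZ coefMXn.
have [ip|ip] := ltnP i (size p); last first.
  rewrite [p`_i]nth_default // expr0n -[X in X == _]prednK ?card_expn_gt0 // mulr0.
  rewrite big1 // => j _; case: ltnP => // _; first by rewrite mulr0.
  rewrite [X in _ * X]nth_default ?mulr0 // (leq_trans sg) //.
  have : ((j : nat).+1 * q ^ e <= i * q ^ e)%N.
    by rewrite leq_mul2r (leq_trans (ltn_ord j)) ?orbT.
  by rewrite mulSn; lia.
rewrite (bigD1 (Ordinal ip)) //= ltnNge leq_addl /= addnK mulrC big1 ?addr0 // => j ji.
have {}ji : (j : nat) != i by apply: contraNneq ji => /eqP.
case: ltnP => [_|jk]; first by rewrite mulr0.
rewrite [X in _ * X]nth_default ?mulr0 // (leq_trans sg) //.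
have [ij|ij] := ltnP j i.
  have : ((j : nat).+1 * q ^ e <= i * q ^ e)%N by rewrite leq_mul2r ij orbT.
  by rewrite mulSn; lia.
have : (i.+1 * q ^ e <= j * q ^ e)%N.
  by rewrite leq_mul2r ltn_neqAle ij [i == _]eq_sym ji orbT.
by rewrite mulSn; lia.
Qed.

(** * Coefficients at sums of distinct Q_d *)

Section Digits.
Variables (r m : nat) (B : {poly C}).
Hypotheses (mr : (m <= r)%N) (sB : (size B <= q ^ m)%N) (B0 : B`_0 = 1).

(** This models the product of the S_n over the degrees 1 to M; the factor of index d belongs to
    degree d + 1. *)
Let Prod M : {poly C} := \prod_(d < M) B ^+ (q ^ (r * d.+1 - m)).
Let digits (D : pred nat) M :=
  (\sum_(d < M) D d * ((q ^ m).-1 * q ^ (r * d.+1 - m)))%N.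

Let mulq M : (q ^ m * q ^ (r * M.+1 - m) = q ^ (r * M.+1))%N.
Proof. by rewrite -expnD; congr (_ ^ _)%N; nia. Qed.

Let leq_step M : (q ^ (r * M) <= q ^ (r * M.+1 - m))%N.
Proof. by rewrite leq_exp2l ?q_gt1 //; nia. Qed.

(** The new factor adds at most (q^m - 1) q^(r(M+1)-m) to the degree, and q^(rM) <= q^(r(M+1)-m), so
    the bound q^(r(M+1)) is kept. *)
Lemma size_prod_expr_card M : (size (Prod M) <= q ^ (r * M))%N.
Proof.
elim: M => [|M IH]; first by rewrite /Prod big_ord0 size_poly1 muln0.
have -> : Prod M.+1 = Prod M * B ^+ (q ^ (r * M.+1 - m)).
  by rewrite /Prod big_ord_recr.
apply: leq_trans (size_polyMleq _ _) _.
have := size_poly_exp_leq B (q ^ (r * M.+1 - m)).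
move: IH sB (leq_step M) (mulq M) (card_expn_gt0 m) (card_expn_gt0 (r * M.+1 - m)).
move: (size (B ^+ _)) (size B) (size (Prod M)) => y [|z] x /=; nia.
Qed.

Lemma digits_lt D M : (digits D M < q ^ (r * M))%N.
Proof.
elim: M => [|M IH]; first by rewrite /digits big_ord0 muln0.
rewrite /digits big_ord_recr /= -/(digits D M) -(mulq M).
move: IH (leq_step M) (card_expn_gt0 m).
move: (digits D M) (q ^ (r * M))%N (q ^ (r * M.+1 - m))%N (q ^ m)%N.
move=> x y z [|a] //= xy yz _; rewrite mulSn.
by case: (D M); rewrite ?mul0n ?mul1n; lia.
Qed.

(* A sum of [Q_d] is written in base [q ^ r] with digits [0] and
   [(q ^ m - 1) q ^ (r - m)], and the exponents of the [d]-th factor only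
   affect the [d]-th digit; so a single product of monomials contributes. *)
Lemma coef_prod_expr_card D M :
  (Prod M)`_(digits D M) =
  \prod_(d < M) (if D d then B`_(q ^ m).-1 ^+ (q ^ (r * d.+1 - m)) else 1).
Proof.
elim: M => [|M IH]; first by rewrite /Prod /digits !big_ord0 coef1.
have IH' := digits_lt D M; have sP := size_prod_expr_card M.
rewrite /Prod /digits !big_ord_recr /= -/(Prod M) -/(digits D M) -IH.
(* The digits below M are the remainder, and [D M] times q^m - 1 is the quotient. *)
rewrite mulnA coefM_expr_card ?(leq_trans _ (leq_step M)) //.
case: (D M); rewrite ?mul1n ?mul0n ?B0 ?expr1n //.
Qed.

End Digits.

End FrobeniusPower.

(** * Transfer to tuples of polynomials of bounded degree *)

Section LinearOnTuples.
Import VectorInternalTheory.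
Context {F : finFieldType} {C : fieldType}.
Variables (kap : {rmorphism F -> C}) (q : nat) (s N : nat).
Hypothesis qE : #|F| = q.
Local Notation V := {ffun 'I_s -> {poly_N F}}.
Variable f : V -> C.
Hypothesis fL : forall c u v, f (c *: u + v) = kap c * f u + f v.

Lemma card_ffun_npoly : #|{: V}| = (q ^ (s * N))%N.
Proof. by rewrite card_ffun card_npoly card_ord qE -expnM mulnC. Qed.

Let r2v_bij : bijective (@r2v F V).
Proof. by exists v2r; [exact: r2vK|exact: v2rK]. Qed.

(** A basis gives a bijection with row vectors, so the dimension is read off from the
    cardinality. *)
Lemma dim_ffun_npoly : dim V = (s * N)%N.
Proof.
apply/eqP; rewrite -(eqn_exp2l _ _ (q_gt1 qE)) -card_ffun_npoly; apply/eqP.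
rewrite -qE -[in LHS](mul1n (dim V)) -card_mx.
exact: bij_eq_card r2v_bij.
Qed.

Let fL' c (u v : 'rV[F]_(dim V)) :
  f (r2v (c *: u + v)) = kap c * f (r2v u) + f (r2v v).
Proof. by rewrite linearP fL. Qed.

Let prod_r2v (g : V -> {poly C}) : \prod_v g v = \prod_(v : 'rV_(dim V)) g (r2v v).
Proof.
by rewrite (reindex (@r2v F V)) //; exact: onW_bij r2v_bij.
Qed.

Lemma prod_linear_qlpoly_ffun :
  exists l, \prod_v ('X - (f v)%:P) = qlpoly q (s * N) l.
Proof.
have [l _ h] := prod_linear_qlpoly qE fL'.
by exists l; rewrite prod_r2v h dim_ffun_npoly.
Qed.

Lemma coef_prod_linear_gap_ffun k :
  (0 < k)%N -> (k < q ^ (s * N) - q ^ (s * N).-1)%N ->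
  (\prod_v (1 - f v *: 'X))`_k = 0.
Proof.
move=> k0; rewrite -dim_ffun_npoly => km.
by rewrite prod_r2v (coef_prod_linear_gap qE fL').
Qed.

End LinearOnTuples.

Lemma prod_split_fset (T : choiceType) (A : comNzRingType) (f : T -> A)
    (s t : {fset T}) : {subset t <= s} ->
  \prod_(x <- s) f x = \prod_(x <- t) f x * \prod_(x <- s | x \notin t) f x.
Proof.
move=> ts; rewrite (bigID (mem t)) /= -[in LHS]big_filter; congr (_ * _).
apply: perm_big; apply: uniq_perm; rewrite ?filter_uniq ?fset_uniq // => x.
by rewrite mem_filter; case xt: (x \in t); rewrite //= ts.
Qed.

(** * The ultrametric absolute value and its limits *)

Section Ultrametric.
Context {R : realType} {F : finFieldType} {C : closedFieldType}.
Variables (iota : {rmorphism {fraction {poly F}} -> C}) (abs : C -> R).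
Hypothesis hC : is_Cinf iota abs.

Local Notation absM := (absM hC).
Local Notation abs_ge0 := (abs_ge0 hC).
Local Notation abs_eq0 := (abs_eq0 hC).

Lemma abs0 : abs 0 = 0.
Proof. exact/abs_eq0. Qed.

Lemma abs_gt0 x : x != 0 -> 0 < abs x.
Proof.
move=> x0; rewrite lt0r abs_ge0 andbT.
by apply: contra_neq x0 => /abs_eq0.
Qed.

Lemma abs1 : abs 1 = 1.
Proof.
have /negPf n0 : abs 1 != 0 by rewrite gt_eqF // abs_gt0 ?oner_neq0.
have /eqP := absM 1 1; rewrite mulr1 -subr_eq0 -{1}[abs 1]mul1r -mulrBl.
by rewrite mulf_eq0 n0 orbF subr_eq0 => /eqP.
Qed.

Lemma absX x n : abs (x ^+ n) = abs x ^+ n.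
Proof. by elim: n => [|n IH]; rewrite ?expr0 ?abs1 // !exprS absM IH. Qed.

Lemma abs_expr1 x n : (0 < n)%N -> x ^+ n = 1 -> abs x = 1.
Proof.
move=> n0 /(congr1 abs); rewrite absX abs1 => /eqP.
by rewrite pexpr_eq1 ?abs_ge0 // => /eqP.
Qed.

Lemma absN x : abs (- x) = abs x.
Proof. by rewrite -mulN1r absM (@abs_expr1 (-1) 2) ?mul1r // sqrrN expr1n. Qed.

Lemma absV x : abs x^-1 = (abs x)^-1.
Proof.
have [->|x0] := eqVneq x 0; first by rewrite invr0 abs0 invr0.
apply: (@mulIf _ (abs x)); first by rewrite gt_eqF // abs_gt0.
by rewrite -absM !mulVf ?abs1 // gt_eqF // abs_gt0.
Qed.

Lemma abs_prod (I : Type) (s : seq I) (P : pred I) (f : I -> C) :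
  abs (\prod_(i <- s | P i) f i) = \prod_(i <- s | P i) abs (f i).
Proof. exact: (big_morph abs absM abs1). Qed.

Lemma absD_le x y b : abs x <= b -> abs y <= b -> abs (x + y) <= b.
Proof. by move=> xb yb; rewrite (le_trans (absD_ultra hC x y)) // ge_max xb yb. Qed.

Lemma absD_lt x y b : abs x < b -> abs y < b -> abs (x + y) < b.
Proof. by move=> xb yb; rewrite (le_lt_trans (absD_ultra hC x y)) // gt_max xb yb. Qed.

Lemma absB_lt x y b : abs x < b -> abs y < b -> abs (x - y) < b.
Proof. by move=> xb yb; rewrite absD_lt // absN. Qed.

Lemma absBC x y : abs (x - y) = abs (y - x).
Proof. by rewrite -opprB absN. Qed.

Lemma abs_sum_le (I : Type) (s : seq I) (P : pred I) (f : I -> C) b : 0 <= b ->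
  (forall i, P i -> abs (f i) <= b) -> abs (\sum_(i <- s | P i) f i) <= b.
Proof.
by move=> b0 fb; elim/big_ind: _ => // [|x y]; [rewrite abs0|exact: absD_le].
Qed.

Lemma abs_sum_lt (I : Type) (s : seq I) (P : pred I) (f : I -> C) b : 0 < b ->
  (forall i, P i -> abs (f i) < b) -> abs (\sum_(i <- s | P i) f i) < b.
Proof.
by move=> b0 fb; elim/big_ind: _ => // [|x y]; [rewrite abs0|exact: absD_lt].
Qed.

Lemma absD_eqr x y : abs x < abs y -> abs (x + y) = abs y.
Proof.
move=> xy; apply/eqP; rewrite eq_le absD_le // ?(ltW xy) //=.
rewrite leNgt; apply/negP => h.
have : abs (x + y - x) < abs y by exact: absB_lt.
by rewrite addrC addrA addNr add0r ltxx.
Qed.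

Lemma abs_near x y : abs (x - y) < abs y -> abs x = abs y.
Proof. by move=> h; rewrite -[x](subrK y) absD_eqr. Qed.

Lemma clim_eps x l : clim abs x l ->
  forall e, 0 < e -> exists N, forall n, (N <= n)%N -> abs (x n - l) < e.
Proof.
move=> /cvgrPdist_lt h e e0; have [N _ hN] := h _ e0; exists N => n Nn.
by have := hN n Nn; rewrite /= sub0r normrN ger0_norm // abs_ge0.
Qed.

Lemma eps_clim x l : (forall e, 0 < e ->
  exists N, forall n, (N <= n)%N -> abs (x n - l) < e) -> clim abs x l.
Proof.
move=> h; apply/cvgrPdist_lt => e e0; have [N hN] := h _ e0; exists N => // n Nn.
by rewrite /= sub0r normrN ger0_norm ?abs_ge0 ?hN.
Qed.

Lemma clim_unique x l l' : clim abs x l -> clim abs x l' -> l = l'.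
Proof.
move=> xl xl'; apply/eqP; rewrite -subr_eq0; apply/negPn/negP => /abs_gt0 e0.
have [N hN] := clim_eps xl e0; have [N' hN'] := clim_eps xl' e0.
have h := hN _ (leq_maxl N N'); have h' := hN' _ (leq_maxr N N').
by have := absB_lt h' h; rewrite opprB addrC addrA subrK ltxx.
Qed.

Lemma climD x y l l' : clim abs x l -> clim abs y l' ->
  clim abs (fun n => x n + y n) (l + l').
Proof.
move=> xl yl; apply: eps_clim => e e0.
have [N hN] := clim_eps xl e0; have [N' hN'] := clim_eps yl e0.
exists (maxn N N') => n; rewrite geq_max => /andP[n1 n2].
by rewrite opprD addrACA absD_lt ?hN ?hN'.
Qed.

Lemma climM a x l : clim abs x l -> clim abs (fun n => a * x n) (a * l).
Proof.
move=> xl; have [->|a0] := eqVneq a 0.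
  by apply: eps_clim => e e0; exists 0%N => n _; rewrite !mul0r subrr abs0.
apply: eps_clim => e e0.
have [|N hN] := clim_eps xl (e := e / abs a); first by rewrite divr_gt0 ?abs_gt0.
exists N => n Nn; rewrite -mulrBr absM mulrC -ltr_pdivlMr ?abs_gt0 //.
exact: hN.
Qed.

(** The ball of radius e <= 1 around 1 is closed under multiplication, by xy - 1 = (x - 1)(y - 1) +
    (x - 1) + (y - 1). *)
Lemma abs_prod_sub1 (I : Type) (s : seq I) (P : pred I) (f : I -> C) e :
  0 <= e <= 1 -> (forall i, P i -> abs (f i - 1) <= e) ->
  abs (\prod_(i <- s | P i) f i - 1) <= e.
Proof.
move=> /andP[e0 e1] fe; elim/big_ind: _ => // [|x y xe ye]; first by rewrite subrr abs0.
have -> : x * y - 1 = (x - 1) * (y - 1) + (x - 1 + (y - 1)).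
  by rewrite mulrBl !mulrBr !mulr1 mul1r; ring.
apply: absD_le; last exact: absD_le.
rewrite absM -[e]mulr1 ler_pM ?abs_ge0 //.
exact: le_trans ye e1.
Qed.

(** * Unconditional infinite products *)

Section InfiniteProduct.
Variables (S : set C) (f : C -> C) (A : nat -> {fset C}).
Hypotheses (AS : forall N, [set` A N] `<=` S)
  (Amono : forall M N, (M <= N)%N -> {subset A M <= A N})
  (Af : forall e, 0 < e -> exists N, forall x, S x -> x \notin A N -> abs (f x - 1) <= e).

Lemma prod_fset_near (e : R) : 0 < e -> exists N, forall s : {fset C},
  [set` s] `<=` S -> {subset A N <= s} ->
  abs (\prod_(x <- s) f x - \prod_(x <- A N) f x) < e.
Proof.
(* Outside [A N1] all factors have absolute value at most 1, so [M] bounds the product over every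
   larger [A N]; [d] then controls the distance of the remaining product to 1. *)
move=> e0; have [N1 hN1] := Af ltr01.
pose M := abs (\prod_(x <- A N1) f x) + 1.
have M0 : 0 < M by rewrite ltr_wpDl // abs_ge0.
pose d := Num.min 1 (e / 2 / M).
have d0 : 0 < d by rewrite lt_min ltr01 !divr_gt0.
have [N2 hN2] := Af d0.
exists (maxn N1 N2) => s sS As.
rewrite (prod_split_fset _ As) -[X in _ - X]mulr1 -mulrBr absM.
have h1 : abs (\prod_(x <- A (maxn N1 N2)) f x) <= M.
  rewrite (prod_split_fset _ (Amono (leq_maxl N1 N2))) absM.
  rewrite -[M]mulr1 ler_pM ?abs_ge0 // ?lerDl // abs_prod.
  rewrite big_seq_cond; apply: prodr_ile1 => x /andP[xA xA1]; rewrite abs_ge0 /=.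
  rewrite -[f x](subrK 1) absD_le ?abs1 // hN1 //.
  exact: AS xA.
have h2 : abs (\prod_(x <- s | x \notin A (maxn N1 N2)) f x - 1) <= d.
  rewrite big_seq_cond; apply: abs_prod_sub1.
    by rewrite (ltW d0) ge_min lexx.
  move=> x /andP[xs xA]; apply: hN2; first exact: sS.
  by apply: contra xA; exact: Amono (leq_maxr _ _) _.
apply: le_lt_trans (ler_pM (abs_ge0 _) (abs_ge0 _) h1 h2) _.
rewrite mulrC -ltr_pdivlMr //.
apply: le_lt_trans (_ : d <= e / 2 / M) _; first by rewrite ge_min lexx orbT.
rewrite ltr_pM2r ?invr_gt0 //; lra.
Qed.

Lemma is_cprod_unique l l' : is_cprod abs S f l -> is_cprod abs S f l' -> l = l'.
Proof.
move=> h h'; apply/eqP; rewrite -subr_eq0; apply/negPn/negP => /abs_gt0 e0.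
have [s sS hs] := h _ e0; have [s' sS' hs'] := h' _ e0.
have sU : [set` s] `<=` [set` s `|` s']%fset by move=> x /= xs; rewrite inE xs.
have sU' : [set` s'] `<=` [set` s `|` s']%fset.
  by move=> x /= xs; rewrite inE xs orbT.
have US : [set` s `|` s']%fset `<=` S.
  by move=> x /=; rewrite inE => /orP[/sS|/sS'].
have := absB_lt (hs' _ sU' US) (hs _ sU US).
by rewrite opprB addrC addrA subrK ltxx.
Qed.

(** The exhaustion [A] reduces the limit over finite sets to a sequential one, which exists by
    completeness; uniqueness identifies it with the value chosen by [xget]. *)
Lemma cprod_clim :
  is_cprod abs S f (cprod abs S f) /\
  clim abs (fun N => \prod_(x <- A N) f x) (cprod abs S f).
Proof.
have [l hl] : exists l, clim abs (fun N => \prod_(x <- A N) f x) l.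
  apply: (C_complete hC) => e e0; have [N hN] := prod_fset_near e0.
  exists N => m n Nm Nn.
  have := absB_lt (hN _ (@AS m) (Amono Nm)) (hN _ (@AS n) (Amono Nn)).
  by rewrite opprB addrA subrK.
have pl : is_cprod abs S f l.
  move=> e e0; have [N1 hN1] := clim_eps hl e0; have [N2 hN2] := prod_fset_near e0.
  exists (A (maxn N1 N2)) => // s As sS.
  have h1 := hN1 _ (leq_maxl N1 N2).
  have h2 := hN2 _ (@AS (maxn N1 N2)) (Amono (leq_maxr _ _)).
  have h3 := hN2 s sS (fun x h => As x (Amono (leq_maxr N1 N2) h)).
  have := absD_lt h3 (absB_lt h1 h2).
  by rewrite [X in abs X](_ : _ = \prod_(x <- s) f x - l) //; ring.
have -> // : cprod abs S f = l.
by rewrite /cprod; apply: xget_unique => // y yl; exact: is_cprod_unique yl pl.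
Qed.

(** All finite products over sets containing s have the same absolute value, and absolute values are
    locally constant away from 0. If the limit is 0, the common value is arbitrarily small, hence
    0. *)
Lemma abs_cprod (s : {fset C}) : [set` s] `<=` S ->
  (forall x, S x -> x \notin s -> abs (f x) = 1) ->
  abs (cprod abs S f) = abs (\prod_(x <- s) f x).
Proof.
move=> sS fs; have [pl _] := cprod_clim; move: pl; move: (cprod abs S f) => l pl.
have H (t : {fset C}) : {subset s <= t} -> [set` t] `<=` S ->
    abs (\prod_(x <- t) f x) = abs (\prod_(x <- s) f x).
  move=> st tS; rewrite (prod_split_fset _ st) absM.
  rewrite [X in _ * X]abs_prod [X in _ * X]big_seq_cond [X in _ * X]big1 ?mulr1 //.
  by move=> x /andP[xt xs]; apply: fs => //; apply: tS.
have K e : 0 < e -> exists2 p, abs p = abs (\prod_(x <- s) f x) & abs (p - l) < e.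
  move=> e0; have [s0 s0S h] := pl _ e0.
  exists (\prod_(x <- (s `|` s0)%fset) f x).
    apply: H => [x xs|x /=]; first by rewrite inE xs.
    by rewrite inE => /orP[/sS|/s0S].
  apply: h => x /=; first by move=> xs; rewrite inE xs orbT.
  by rewrite inE => /orP[/sS|/s0S].
have [l0|l0] := eqVneq l 0; last first.
  have [p <- pl'] := K _ (abs_gt0 l0); exact/esym/abs_near.
apply/eqP; rewrite l0 abs0 eq_le abs_ge0 /= leNgt; apply/negP => e0.
by have [p <-] := K _ e0; rewrite l0 subr0 ltxx.
Qed.

End InfiniteProduct.
End Ultrametric.

Lemma expr_subn_div (K : fieldType) (x : K) i n :
  x != 0 -> (i <= n)%N -> x ^+ n / x ^+ (n - i) = x ^+ i.
Proof. by move=> x0 i_n; rewrite -{1}(subnKC i_n) exprD mulfK // expf_neq0. Qed.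

(** * Absolute values of polynomials *)

Section PolyNorm.
Context {R : realType} {F : finFieldType} {C : closedFieldType}.
Variables (iota : {rmorphism {fraction {poly F}} -> C}) (abs : C -> R).
Hypothesis hC : is_Cinf iota abs.
Variable q : nat.
Hypothesis qE : #|F| = q.

Definition kapC : {rmorphism F -> C} := iota \o (@FracField.tofrac _) \o polyC.

Local Notation pa a := (iota (fracA a)).

Definition nrm (a : {poly F}) : R := if a == 0 then 0 else q%:R ^+ (size a).-1.

Lemma qR_gt1 : 1 < q%:R :> R.
Proof. by rewrite ltr1n (q_gt1 qE). Qed.

Lemma qR_gt0 : 0 < q%:R :> R.
Proof. exact: lt_trans qR_gt1. Qed.

Lemma nrm_ge0 a : 0 <= nrm a.
Proof. by rewrite /nrm; case: ifP => // _; rewrite exprn_ge0 // ltW // qR_gt0. Qed.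

Lemma nrm_gt0 a : a != 0 -> 0 < nrm a.
Proof. by rewrite /nrm => /negPf ->; rewrite exprn_gt0 // qR_gt0. Qed.

Lemma nrm_le (a b : {poly F}) : (size a <= size b)%N -> nrm a <= nrm b.
Proof.
rewrite /nrm; have [//|a0] := eqVneq a 0.
  by have := nrm_ge0 b; rewrite /nrm.
have [->|b0 ab] := eqVneq b 0; first by rewrite size_poly0 leqn0 size_poly_eq0 (negPf a0).
by rewrite ler_eXn2l ?qR_gt1 // -!subn1 leq_sub2r.
Qed.

Lemma nrm_size_gt N (a : {poly F}) : (N < size a)%N -> q%:R ^+ N <= nrm a.
Proof.
move=> Na; rewrite /nrm; case: eqP Na => [->|_ Na]; first by rewrite size_poly0.
by rewrite ler_eXn2l ?qR_gt1 //; lia.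
Qed.

Lemma nrm_lt_size e (a b : {poly F}) :
  b != 0 -> (size a + e <= size b)%N -> nrm a * q%:R ^+ e <= nrm b.
Proof.
move=> b0; rewrite /nrm (negPf b0); case: eqP => [->|/eqP a0] ab.
  by rewrite mul0r exprn_ge0 // ltW // qR_gt0.
rewrite -exprD ler_eXn2l ?qR_gt1 //.
by move: a0 ab; rewrite -size_poly_gt0; lia.
Qed.

(** Nonzero constants are roots of unity. *)
Lemma abs_kapC c : c != 0 -> abs (kapC c) = 1.
Proof.
move=> c0; apply: (@abs_expr1 _ _ _ _ _ hC _ #|F|.-1).
  by rewrite -subn1 subn_gt0 finNzRing_gt1.
apply: (@mulIf _ (kapC c)); first by rewrite fmorph_eq0.
by rewrite mul1r -exprSr prednK ?(ltnW (finNzRing_gt1 F)) // -rmorphXn /= expf_card.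
Qed.

(** Horner's scheme: in p T + c with p nonzero, the first term strictly dominates the constant. *)
Lemma abs_pa a : abs (pa a) = nrm a.
Proof.
elim/poly_ind: a => [|p c IH]; first by rewrite /nrm eqxx !rmorph0 (abs0 hC).
have [->|p0] := eqVneq p 0.
  rewrite mul0r add0r /nrm polyC_eq0.
  have [->|c0] := eqVneq c 0; first by rewrite !rmorph0 (abs0 hC).
  by rewrite size_polyC c0 expr0 -(abs_kapC c0).
have apX : abs (pa (p * 'X)) = nrm p * q%:R.
  by rewrite !rmorphM /= (absM hC) IH (abs_T hC) qE.
have sz : size (p * 'X + c%:P) = (size p).+1 by rewrite size_MXaddC (negPf p0).
have -> : nrm (p * 'X + c%:P) = nrm p * q%:R.
  rewrite /nrm sz (negPf p0) -size_poly_eq0 sz /= -exprSr prednK //.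
  by rewrite size_poly_gt0.
rewrite !rmorphD /= addrC -apX; apply: (absD_eqr hC).
rewrite apX /nrm (negPf p0) -exprSr prednK ?size_poly_gt0 //.
apply: (@le_lt_trans _ _ 1).
  have [->|c0] := eqVneq c 0; first by rewrite !rmorph0 (abs0 hC).
  by rewrite -(abs_kapC c0).
by rewrite exprn_egt1 ?qR_gt1 // -lt0n size_poly_gt0.
Qed.

Lemma Kinf_pa a : Kinf iota abs (pa a).
Proof.
(* The Laurent series starts at T^(size a), above the degree, so [b 0] is the vanishing coefficient
   of index [size a]; this is the term dropped after the reversal below. *)
pose b i := if (i <= size a)%N then a`_(size a - i) else 0.
exists (size a), b; apply: (eps_clim hC) => e e0; exists (size a).+1 => n an.
suff -> : \sum_(i < n)
    iota (fracA (b i)%:P * fracA 'X ^+ size a / fracA 'X ^+ i) = pa a.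
  by rewrite subrr (abs0 hC).
have X0 : fracA ('X : {poly F}) != 0 by rewrite tofrac_eq0 polyX_eq0.
rewrite -(subnKC an) big_split_ord /= [X in _ + X]big1 ?addr0; last first.
  move=> i _; rewrite /b addSn ltnNge leq_addr /=.
  by rewrite !rmorph0 !mul0r rmorph0.
rewrite -[in RHS](coefK a) poly_def !rmorph_sum /=.
rewrite (reindex_inj rev_ord_inj) /= big_ord_recr /= subnn.
rewrite [X in _ + X](_ : _ = 0) ?addr0; last first.
  by rewrite /b leq0n subn0 nth_default // !rmorph0 !mul0r rmorph0.
apply: eq_bigr => i _; congr (iota _).
rewrite /b subSS leq_subr subKn; last exact: ltnW.
rewrite -mul_polyC rmorphM rmorphXn -mulrA; congr (_ * _).
exact: (expr_subn_div X0 (ltnW (ltn_ord i))).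
Qed.

End PolyNorm.

(** * The exponential function of an orthogonal lattice *)

Section LatticeExp.
Context {R : realType} {F : finFieldType} {C : closedFieldType}.
Variables (iota : {rmorphism {fraction {poly F}} -> C}) (abs : C -> R).
Hypothesis hC : is_Cinf iota abs.
Variable q : nat.
Hypothesis qE : #|F| = q.

Local Notation pa a := (iota (fracA a)).
Local Notation nrm := (@nrm R F q).
Local Notation kap := (kapC iota).

Variables (s : nat) (kappa : 'I_s -> nat).

Definition vnorm (a : 'I_s -> {poly F}) : R :=
  \big[Num.max/0]_i (nrm (a i) * q%:R ^+ kappa i).

(** This is |e(z)| for rho = |z| when |z - l| = max(|z|, |l|) for all lattice points l. The
    truncation at N is harmless once all further lattice points have absolute value above rho. *)
Definition radial (N : nat) (rho : R) : R :=
  rho * \prod_(b : {ffun 'I_s -> {poly_N F}} | b != 0)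
          Num.max 1 (rho / vnorm (fun i => b i : {poly F})).

(** The factors are positive and nondecreasing in rho; strictness comes from the leading factor
    rho. *)
Lemma radial_lt N rho rho' : 0 <= rho -> rho < rho' -> radial N rho < radial N rho'.
Proof.
move=> r0 rr'; have r0' : 0 < rho' := le_lt_trans r0 rr'.
apply: (@le_lt_trans _ _ (rho * \prod_(b : {ffun 'I_s -> {poly_N F}} | b != 0)
          Num.max 1 (rho' / vnorm (fun i => b i : {poly F})))).
  rewrite ler_wpM2l // ler_prod // => b _.
  rewrite le_max ler01 /= ge_max !le_max lexx /= ler_wpM2r ?orbT //; last exact: ltW.
  by rewrite invr_ge0; exact: bigmax_ge_id.
rewrite ltr_pM2r // prodr_gt0 // => b _.
by rewrite lt_max ltr01.
Qed.

Variable w : 'I_s -> C.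
Hypotheses (ow : Defs.orthogonal iota abs w)
  (wk : forall i, abs (w i) = q%:R ^+ kappa i).

Definition lam (a : 'I_s -> {poly F}) : C := \sum_i pa (a i) * w i.

Lemma abs_lam a : abs (lam a) = vnorm a.
Proof.
rewrite /lam ow; last by move=> i; exact: Kinf_pa.
by apply: eq_bigr => i _; rewrite (absM hC) wk (abs_pa hC qE).
Qed.

Lemma lam_eq0 a : lam a = 0 -> forall i, a i = 0.
Proof.
move=> /(congr1 abs); rewrite abs_lam (abs0 hC) => h i; apply/eqP.
apply/negPn/negP => ai; suff : 0 < vnorm a by rewrite h ltxx.
apply: lt_le_trans (le_bigmax _ _ i).
by rewrite mulr_gt0 ?nrm_gt0 // exprn_gt0 // (qR_gt0 qE).
Qed.

Lemma lamD a b : lam (fun i => a i + b i) = lam a + lam b.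
Proof. by rewrite /lam -big_split; apply: eq_bigr => i _ /=; rewrite !rmorphD mulrDl. Qed.

Lemma lamM p a : lam (fun i => p * a i) = pa p * lam a.
Proof. by rewrite /lam mulr_sumr; apply: eq_bigr => i _ /=; rewrite !rmorphM mulrA. Qed.

Lemma lamB a b : lam (fun i => a i - b i) = lam a - lam b.
Proof. by rewrite /lam -sumrB; apply: eq_bigr => i _ /=; rewrite !rmorphB mulrBl. Qed.

Lemma lamZ c a : lam (fun i => c *: a i) = kap c * lam a.
Proof. by rewrite -lamM; apply: eq_bigr => i _; rewrite mul_polyC. Qed.

Local Notation V N := {ffun 'I_s -> {poly_N F}}.

Definition lamf N (a : V N) : C := lam (fun i => a i : {poly F}).

Lemma lamfL N c (u v : V N) : lamf (c *: u + v) = kap c * lamf u + lamf v.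
Proof.
by rewrite -lamZ -lamD; apply: eq_bigr => i _; rewrite !ffunE.
Qed.

Lemma lamf_eq0 N (a : V N) : (lamf a == 0) = (a == 0).
Proof.
apply/eqP/eqP => [h|->].
  by apply/ffunP => i; apply/val_inj; rewrite /= (lam_eq0 h) ffunE.
by rewrite /lamf /lam big1 // => i _; rewrite ffunE !rmorph0 mul0r.
Qed.

Lemma lamf_inj N : injective (@lamf N).
Proof.
move=> a b ab; apply/eqP; rewrite -subr_eq0 -lamf_eq0 addrC -scaleN1r lamfL.
by rewrite rmorphN1 ab mulN1r addNr.
Qed.

(** A ball for the degrees of the coordinates; these finite sets exhaust the nonzero lattice points,
    and adjoining 0 gives F-spaces. *)
Definition ball_lattice N : {fset C} :=
  [fset x in [seq lamf a | a <- index_enum (V N) & a != 0]]%fset.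

Lemma in_ball_lattice N x : x \in ball_lattice N <->
  exists a : 'I_s -> {poly F}, [/\ forall i, (size (a i) <= N)%N, x = lam a & x <> 0].
Proof.
rewrite inE /=; split.
  move=> /mapP[a]; rewrite mem_filter => /andP[a0 _] ->.
  exists (fun i => a i : {poly F}); split=> //.
  by apply/eqP; rewrite lamf_eq0.
move=> [a [sa -> x0]]; apply/mapP.
have e : lam a = lamf [ffun i => NPoly (sa i)].
  by apply: eq_bigr => i _; rewrite ffunE.
exists [ffun i => NPoly (sa i)] => //.
by rewrite mem_filter mem_index_enum -lamf_eq0 -e andbT; apply/eqP.
Qed.

Lemma prod_ball_lattice N (f : C -> C) :
  \prod_(x <- ball_lattice N) f x = \prod_(a : V N | a != 0) f (lamf a).
Proof.
rewrite -[RHS]big_filter -(big_map (@lamf N) xpredT f).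
apply: perm_big; apply: uniq_perm; rewrite ?fset_uniq //.
  by rewrite map_inj_uniq ?filter_uniq ?index_enum_uniq //; exact: lamf_inj.
by move=> x; rewrite inE.
Qed.

Let S := [set l | lattice iota w l /\ l <> 0].

Lemma ball_lattice_sub N : [set` ball_lattice N] `<=` S.
Proof. by move=> x /in_ball_lattice[a [_ -> x0]]; split => //; exists a. Qed.

Lemma ball_lattice_mono M N : (M <= N)%N -> {subset ball_lattice M <= ball_lattice N}.
Proof.
move=> MN x /in_ball_lattice[a [sa xa x0]]; apply/in_ball_lattice; exists a.
by split => // i; exact: leq_trans (sa i) MN.
Qed.

(** Some coordinate has degree at least N, and |w_i| >= 1. *)
Lemma abs_notin_ball x N : S x -> x \notin ball_lattice N -> q%:R ^+ N <= abs x.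
Proof.
move=> [[a xa] x0] xN.
have [i Ni] : exists i, (N < size (a i))%N.
  apply: contrapT => h; move/negP: xN; apply; apply/in_ball_lattice; exists a.
  by split => // i; rewrite leqNgt; apply/negP => hi; apply: h; exists i.
rewrite xa -[\sum_i _]/(lam a) abs_lam.
apply: le_trans (le_bigmax _ _ i); rewrite -[X in X <= _]mulr1.
rewrite ler_pM ?exprn_ge0 ?(ltW (qR_gt0 qE)) ?nrm_size_gt //.
by rewrite exprn_ege1 // ltW // (qR_gt1 qE).
Qed.

Section Exp.
Variable z : C.

Let Af (e : R) : 0 < e -> exists N, forall x, S x -> x \notin ball_lattice N ->
  abs (1 - z / x - 1) <= e.
Proof.
(* With this N, |z| / e < N <= q^N, so |z / x| <= e as soon as |x| >= q^N. *)
move=> e0; pose N := Num.bound (abs z / e); exists N => x Sx xN.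
rewrite addrAC subrr add0r (absN hC) (absM hC) (absV hC).
have hx := abs_notin_ball Sx xN.
have x0 : 0 < abs x by apply: lt_le_trans hx; rewrite exprn_gt0 // (qR_gt0 qE).
rewrite ler_pdivrMr // mulrC -ler_pdivrMr //; apply: le_trans hx.
have : 0 <= abs z / e by rewrite divr_ge0 ?(abs_ge0 hC) // ltW.
move=> /archi_boundP/ltW/le_trans; apply.
by rewrite -natrX ler_nat ltnW // ltn_expl // (q_gt1 qE).
Qed.

Definition exp_partial N := z * \prod_(a : V N | a != 0) (1 - z / lamf a).

Lemma lattice_exp_clim : clim abs exp_partial (lattice_exp abs (lattice iota w) z).
Proof.
have [_ h] := cprod_clim hC ball_lattice_sub ball_lattice_mono Af.
rewrite (_ : exp_partial = fun N => z * \prod_(x <- ball_lattice N) (1 - z / x)).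
  exact: (climM hC z h).
by apply/funext => N; rewrite /exp_partial prod_ball_lattice.
Qed.

Lemma abs_lattice_exp N : (forall x, S x -> x \notin ball_lattice N -> abs z < abs x) ->
  abs (lattice_exp abs (lattice iota w) z) =
  abs z * \prod_(a : V N | a != 0) abs (1 - z / lamf a).
Proof.
move=> h; rewrite /lattice_exp (absM hC); congr (_ * _).
rewrite (abs_cprod hC ball_lattice_sub ball_lattice_mono Af (s := ball_lattice N)).
- by rewrite prod_ball_lattice (abs_prod hC).
- exact: ball_lattice_sub.
move=> x Sx xN; rewrite addrC (absD_eqr hC) (abs1 hC) // (absN hC) (absM hC) (absV hC).
rewrite ltr_pdivrMr ?mul1r; first exact: h.
by apply: (abs_gt0 hC); apply/eqP; case: Sx.
Qed.

End Exp.

Local Notation expL := (lattice_exp abs (lattice iota w)).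

(** Up to a constant, the partial product is the monic polynomial whose roots form a finite F-space.
    F-linearity of e follows in the limit. *)
Lemma exp_partial_qlpoly N : exists k l, forall z,
  exp_partial z N = k * (qlpoly q (s * N) l).[z].
Proof.
have [l hl] := prod_linear_qlpoly_ffun qE (@lamfL N).
exists (\prod_(a : V N | a != 0) (- lamf a))^-1, l => z.
rewrite -hl horner_prod [X in _ * X](bigD1 (0 : V N)) //= hornerXsubC /exp_partial.
have /eqP -> : lamf (0 : V N) == 0 by rewrite lamf_eq0.
rewrite subr0 mulrCA; congr (_ * _); rewrite -prodfV -big_split /=.
apply: eq_bigr => a a0; have l0 : lamf a != 0 by rewrite lamf_eq0.
by rewrite hornerXsubC [RHS]mulrC mulrBl invrN !mulrN opprK divff // addrC.
Qed.

Lemma lattice_expD x y : expL (x + y) = expL x + expL y.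
Proof.
apply: (clim_unique hC (lattice_exp_clim _)).
rewrite (_ : exp_partial (x + y) = fun N => exp_partial x N + exp_partial y N).
  exact: (climD hC (lattice_exp_clim _) (lattice_exp_clim _)).
apply/funext => N; have [k [l h]] := exp_partial_qlpoly N.
by rewrite !h (horner_qlpolyD kap qE) mulrDr.
Qed.

Lemma lattice_expZ c x : expL (kap c * x) = kap c * expL x.
Proof.
apply: (clim_unique hC (lattice_exp_clim _)).
rewrite (_ : exp_partial (kap c * x) = fun N => kap c * exp_partial x N).
  exact: (climM hC _ (lattice_exp_clim _)).
apply/funext => N; have [k [l h]] := exp_partial_qlpoly N.
by rewrite !h (horner_qlpolyZ kap qE) mulrCA.
Qed.

Lemma lattice_expB x y : expL (x - y) = expL x - expL y.
Proof.
by rewrite lattice_expD -mulN1r -(rmorphN1 kap) lattice_expZ rmorphN1 mulN1r.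
Qed.

(* Points of [K^s w] are given by numerators [a] over a common denominator [n],
   so that orthogonality is only needed for polynomial coefficients. *)
Definition frac_point (n : {poly F}) (a : 'I_s -> {poly F}) : C := lam a / pa n.

Lemma abs_frac_point n a : abs (frac_point n a) = vnorm a / nrm n.
Proof. by rewrite (absM hC) (absV hC) abs_lam (abs_pa hC qE). Qed.

Section Reduced.
Variables (n : {poly F}) (a : 'I_s -> {poly F}).
Hypothesis an : forall i, (size (a i) < size n)%N.

(** For |l| > |z| this is the ultrametric equality. Otherwise z - l has numerators a_i - n b_i, of
    degree at least that of a_i because deg a_i < deg n. *)
Lemma abs_frac_point_sub b : n != 0 ->
  abs (frac_point n a - lam b) = Num.max (abs (frac_point n a)) (abs (lam b)).
Proof.
move=> nn0; have [lt|ge] := ltP (abs (frac_point n a)) (abs (lam b)).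
  by rewrite (absD_eqr hC) ?(absN hC).
apply/eqP; rewrite eq_le (absD_le hC) ?(absN hC) //=.
have pn0 : pa n != 0 by rewrite fmorph_eq0 tofrac_eq0.
have -> : frac_point n a - lam b = frac_point n (fun i => a i - n * b i).
  by rewrite /frac_point lamB lamM mulrBl [pa n * _]mulrC mulfK.
rewrite !abs_frac_point ler_wpM2r ?invr_ge0 ?nrm_ge0 //.
apply: le_bigmax2 => i _; rewrite ler_wpM2r ?exprn_ge0 ?(ltW (qR_gt0 qE)) //.
apply: nrm_le => //; have [->|b0] := eqVneq (b i) 0; first by rewrite mulr0 subr0.
have sn : (size (a i) < size (n * b i)%R)%N.
  by apply: leq_trans (an i) _; rewrite size_mul // -subn1 -addnBA ?leq_addr ?size_poly_gt0.
by rewrite addrC size_polyDl size_polyN // ltnW.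
Qed.

Variable K : nat.
Hypothesis kK : forall i, (kappa i <= K)%N.

Lemma abs_frac_point_le : abs (frac_point n a) <= q%:R ^+ K / q%:R.
Proof.
have q0 := @qR_gt0 R _ _ qE.
rewrite abs_frac_point; have [->|nn0] := eqVneq n 0.
  by rewrite /nrm eqxx invr0 mulr0 divr_ge0 ?exprn_ge0 // ltW.
rewrite ler_pdivrMr ?nrm_gt0 //; apply: bigmax_le => [|i _].
  by rewrite mulr_ge0 ?nrm_ge0 // divr_ge0 ?exprn_ge0 // ltW.
rewrite mulrAC ler_pdivlMr //.
rewrite (_ : _ * q%:R = q%:R ^+ kappa i * (nrm (a i) * q%:R)); last by ring.
rewrite ler_pM ?exprn_ge0 ?mulr_ge0 ?nrm_ge0 ?(ltW q0) //.
  by rewrite ler_eXn2l ?(qR_gt1 qE).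
by rewrite -[q%:R]expr1 nrm_lt_size // addn1.
Qed.

Lemma abs_exp_frac_point : n != 0 ->
  abs (expL (frac_point n a)) = radial K (abs (frac_point n a)).
Proof.
have q0 := @qR_gt0 R _ _ qE; move=> nn0; rewrite (@abs_lattice_exp _ K).
  congr (_ * _); apply: eq_bigr => b b0; have l0 : lamf b != 0 by rewrite lamf_eq0.
  rewrite -(divff l0) -mulrBl (absM hC) (absBC hC) abs_frac_point_sub // (absV hC).
  rewrite maxr_pMl ?invr_ge0 ?(abs_ge0 hC) // divff ?gt_eqF ?(abs_gt0 hC) // maxC.
  by rewrite abs_lam.
(* Lattice points outside [ball_lattice K] have absolute value at least q^K, while |z| <= q^(K-1);
   hence the truncation at K. *)
move=> x Sx xK; apply: lt_le_trans (abs_notin_ball Sx xK).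
apply: le_lt_trans abs_frac_point_le _.
by rewrite ltr_pdivrMr // ltr_pMr ?exprn_gt0 // (qR_gt1 qE).
Qed.

Lemma abs_exp_frac_point_le : n != 0 ->
  abs (expL (frac_point n a)) <= radial K (q%:R ^+ K / q%:R).
Proof.
move=> nn0; rewrite abs_exp_frac_point //.
have := abs_frac_point_le; rewrite le_eqVlt => /orP[/eqP ->//|h].
by rewrite ltW // radial_lt // (abs_ge0 hC).
Qed.

Lemma abs_exp_frac_point_lt : n != 0 -> abs (frac_point n a) < q%:R ^+ K / q%:R ->
  abs (expL (frac_point n a)) < radial K (q%:R ^+ K / q%:R).
Proof.
by move=> nn0 h; rewrite abs_exp_frac_point // radial_lt // (abs_ge0 hC).
Qed.

End Reduced.
End LatticeExp.

(** * Series with geometrically bounded coefficients *)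

Section Congruence.
Context {R : realType} {F : finFieldType} {C : closedFieldType}.
Variables (iota : {rmorphism {fraction {poly F}} -> C}) (abs : C -> R).
Hypothesis hC : is_Cinf iota abs.
Variable c : R.
Hypothesis c0 : 0 < c.

(** The pair plays the role of the valuation ring and its maximal ideal, the k-th coefficient being
    measured against c^k. *)
Definition geom_bounded (f : nat -> C) := forall k, abs (f k) <= c ^+ k.
Definition geom_small (f : nat -> C) := forall k, abs (f k) < c ^+ k.

Lemma geom_boundedM f g : geom_bounded f -> geom_bounded g -> geom_bounded (fps_mul f g).
Proof.
move=> hf hg k; apply: (abs_sum_le hC) => [|i _]; first by rewrite exprn_ge0 // ltW.
rewrite (absM hC) -[k in c ^+ k](subnKC (leq_ord i)) exprD.
by rewrite ler_pM ?(abs_ge0 hC).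
Qed.

Lemma geom_smallM f g : geom_small f -> geom_bounded g -> geom_small (fps_mul f g).
Proof.
move=> hf hg k; apply: (abs_sum_lt hC) => [|i _]; first by rewrite exprn_gt0.
rewrite (absM hC) -[k in c ^+ k](subnKC (leq_ord i)) exprD.
apply: (@le_lt_trans _ _ (abs (f i) * c ^+ (k - i))).
  by rewrite ler_wpM2l ?(abs_ge0 hC).
by rewrite ltr_pM2r ?exprn_gt0.
Qed.

Lemma geom_bounded_fps_exp f n : geom_bounded f -> geom_bounded (fps_exp f n).
Proof.
move=> hf; elim: n => [|n IH]; last exact: geom_boundedM.
by move=> [|k] /=; rewrite ?(abs1 hC) ?expr0 ?(abs0 hC) // exprn_ge0 // ltW.
Qed.

(* Equality after reduction modulo the maximal ideal, in the variable [t / c]. *)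
Definition geom_cong (p p' : {poly C}) := [/\ geom_bounded (nth 0 p),
  geom_bounded (nth 0 p') & geom_small (fun k => p`_k - p'`_k)].

Lemma coef_fps_mul (p p' : {poly C}) k : (p * p')`_k = fps_mul (nth 0 p) (nth 0 p') k.
Proof. by rewrite coefM. Qed.

(** The splitting p1 p2 - p1' p2' = (p1 - p1') p2 + p1' (p2 - p2'); the bounds included in
    [geom_cong] make both terms small. *)
Lemma geom_congM p1 p2 p1' p2' :
  geom_cong p1 p1' -> geom_cong p2 p2' -> geom_cong (p1 * p2) (p1' * p2').
Proof.
move=> [b1 b1' s1] [b2 b2' s2]; split=> k; rewrite ?coef_fps_mul; try exact: geom_boundedM.
have -> : fps_mul (nth 0 p1) (nth 0 p2) k - fps_mul (nth 0 p1') (nth 0 p2') k =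
    fps_mul (fun k => p1`_k - p1'`_k) (nth 0 p2) k +
    fps_mul (nth 0 p1') (fun k => p2`_k - p2'`_k) k.
  by rewrite /fps_mul -sumrB -big_split; apply: eq_bigr => i _ /=; ring.
apply: (absD_lt hC); first exact: geom_smallM.
have -> : fps_mul (nth 0 p1') (fun k => p2`_k - p2'`_k) k =
    fps_mul (fun k => p2`_k - p2'`_k) (nth 0 p1') k.
  rewrite /fps_mul (reindex_inj rev_ord_inj); apply: eq_bigr => i _ /=.
  by rewrite subSS mulrC subKn // -ltnS.
exact: geom_smallM.
Qed.

Lemma geom_cong1 : geom_cong 1 1.
Proof.
have b : geom_bounded (nth 0 (1 : {poly C})).
  move=> [|k]; rewrite coef1 /=; first by rewrite (abs1 hC) expr0.
  by rewrite (abs0 hC) exprn_ge0 // ltW.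
by split=> // k; rewrite subrr (abs0 hC) exprn_gt0.
Qed.

Lemma geom_cong_prod (I : Type) (s : seq I) (P : pred I) (f g : I -> {poly C}) :
  (forall i, P i -> geom_cong (f i) (g i)) ->
  geom_cong (\prod_(i <- s | P i) f i) (\prod_(i <- s | P i) g i).
Proof.
move=> fg; apply: (big_ind2 geom_cong) => //; first exact: geom_cong1.
by move=> *; exact: geom_congM.
Qed.

Lemma geom_cong_1subZX a b :
  abs a <= c -> abs b <= c -> abs (a - b) < c -> geom_cong (1 - a *: 'X) (1 - b *: 'X).
Proof.
have cE x k : (1 - x *: 'X : {poly C})`_k =
    if k is k'.+1 then (if k' is 0 then - x else 0) else 1.
  rewrite coefB coef1 coefZ coefX; case: k => [|[|k]] /=.
  - by rewrite mulr0 subr0.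
  - by rewrite mulr1 sub0r.
  by rewrite mulr0 subr0.
have bd x : abs x <= c -> geom_bounded (nth 0 (1 - x *: 'X : {poly C})).
  move=> xc k; rewrite cE; case: k => [|[|k]]; rewrite ?(abs1 hC) ?(absN hC) ?expr1 //.
  by rewrite (abs0 hC) exprn_ge0 // ltW.
move=> ac bc ab; split; try exact: bd.
move=> k; rewrite !cE; case: k => [|[|k]]; rewrite ?subrr ?(abs0 hC) ?exprn_gt0 //.
by rewrite expr1 -opprD (absN hC).
Qed.

End Congruence.

(** * Reduction of the product function *)

Section ProductFunction.
Context {R : realType} {F : finFieldType} {C : closedFieldType}.
Variables (iota : {rmorphism {fraction {poly F}} -> C}) (abs : C -> R).
Hypothesis hC : is_Cinf iota abs.
Variable q : nat.
Hypothesis qE : #|F| = q.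

Local Notation pa a := (iota (fracA a)).
Local Notation nrm := (@nrm R F q).
Local Notation kap := (kapC iota).

Variables (s K m : nat) (kappa : 'I_s -> nat).
Hypotheses (s0 : (0 < s)%N) (m0 : (0 < m)%N) (ms : (m <= s)%N).
Hypotheses (kK : forall i : 'I_s, (i < m)%N -> kappa i = K)
  (kltK : forall i : 'I_s, (m <= i)%N -> (kappa i < K)%N).

Variable w : 'I_s -> C.
Hypotheses (ow : Defs.orthogonal iota abs w)
  (wk : forall i, abs (w i) = q%:R ^+ kappa i).

Local Notation expL := (lattice_exp abs (lattice iota w)).
Local Notation fpt := (frac_point iota w).
Local Notation V d := {ffun 'I_s -> {poly_d F}}.

(** The constant c(k'): q^(K-1) is the largest possible absolute value of a point with coordinates
    of absolute value < 1. *)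
Definition cmax : R := @radial R F q s kappa K (q%:R ^+ K / q%:R).

Let kleK i : (kappa i <= K)%N.
Proof. by have [/kK -> //|/kltK/ltnW] := ltnP i m. Qed.

Lemma cmax_gt0 : 0 < cmax.
Proof.
have rho0 : 0 < q%:R ^+ K / q%:R :> R by rewrite divr_gt0 ?exprn_gt0 // (qR_gt0 qE).
have := @radial_lt R F q s kappa K _ _ (lexx 0) rho0.
by rewrite {1}/radial mul0r.
Qed.

Lemma division_fun_frac n (a : 'I_s -> {poly F}) :
  division_fun iota abs (fun i => fracA (a i) / fracA n) w = expL (fpt n a).
Proof.
rewrite /division_fun; congr expL; rewrite /frac_point /lam mulr_suml.
by apply: eq_bigr => i _; rewrite fmorph_div mulrAC.
Qed.

Definition divf (n : {poly F}) d (a : V d) : C := expL (fpt n (fun i => a i : {poly F})).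

Lemma divfL n d c (u v : V d) : divf n (c *: u + v) = kap c * divf n u + divf n v.
Proof.
rewrite /divf -(lattice_expZ hC qE ow wk) -(lattice_expD hC qE ow wk); congr expL.
rewrite /frac_point mulrA -mulrDl; congr (_ / _); exact: lamfL.
Qed.

Lemma divf0 n d : divf n (0 : V d) = 0.
Proof.
have := divfL n (-1) (0 : V d) 0.
by rewrite scaler0 addr0 rmorphN1 mulN1r addNr.
Qed.

Lemma S_polyE n : S_poly iota abs n w = \prod_(a : V (size n).-1) (1 - divf n a *: 'X).
Proof.
rewrite [RHS](bigD1 (0 : V (size n).-1)) //= divf0 scale0r subr0 mul1r.
by apply: eq_bigr => a _; rewrite division_fun_frac.
Qed.

Lemma S_poly_coef0 n : (S_poly iota abs n w)`_0 = 1.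
Proof.
rewrite -horner_coef0 horner_prod big1 // => a _.
by rewrite hornerD hornerN hornerZ hornerX hornerC mulr0 subr0.
Qed.

(** A cruder gap than q^(sd) - q^(sd-1) with d = deg n; it still grows with d, so only finitely many
    n affect a given coefficient. *)
Lemma S_poly_gap (n : {poly F}) k :
  (0 < k)%N -> (k < (size n).-1)%N -> (S_poly iota abs n w)`_k = 0.
Proof.
move=> k0 kn; rewrite S_polyE (coef_prod_linear_gap_ffun qE (@divfL n (size n).-1)) //.
have q1 := q_gt1 qE.
have [N EN] : exists N, (s * (size n).-1 = N.+1)%N.
  by exists (s * (size n).-1).-1; rewrite prednK // muln_gt0 s0 (leq_trans _ kn).
rewrite EN /= expnS.
have : (N < q ^ N)%N by rewrite ltn_expl.
have : ((size n).-1 <= N.+1)%N by rewrite -EN leq_pmull.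
nia.
Qed.

Definition monics M : {fset {poly F}} :=
  [fset x in map (fun p : {poly_M.+1 F} => p : {poly F})
     [seq p : {poly_M.+1 F} <- index_enum {poly_M.+1 F} | (p : {poly F}) \is monic]]%fset.

Lemma in_monics M (n : {poly F}) :
  (n \in monics M) = (n \is monic) && (size n <= M.+1)%N.
Proof.
rewrite inE /=; apply/mapP/andP => [[p]|[nm sn]].
  by rewrite mem_filter => /andP[pm _] ->; split.
by exists (NPoly sn); rewrite // mem_filter mem_index_enum nm.
Qed.

(** For deg n > k, S_n is 1 modulo t^(k+1), so enlarging [monics k] changes nothing. The value
    chosen by [xget] is compared with this one on a union of finite sets. *)
Lemma product_coefE k :
  product_coef iota abs w k = (\prod_(n <- monics k) S_poly iota abs n w)`_k.
Proof.
have H (t : {fset {poly F}}) : {subset monics k <= t} -> (forall n, n \in t -> n \is monic) ->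
    (\prod_(n <- t) S_poly iota abs n w)`_k = (\prod_(n <- monics k) S_poly iota abs n w)`_k.
  move=> st tm; rewrite (prod_split_fset _ st).
  have [u0 ui] : (\prod_(n <- t | n \notin monics k) S_poly iota abs n w)`_0 = 1 /\
      forall i, (0 < i)%N -> (i <= k)%N ->
      (\prod_(n <- t | n \notin monics k) S_poly iota abs n w)`_i = 0.
    rewrite big_seq_cond; apply: (big_ind (fun p : {poly C} => p`_0 = 1 /\
      forall i, (0 < i)%N -> (i <= k)%N -> p`_i = 0)).
    - by split; [rewrite coef1|move=> [|i] // _ _; rewrite coef1].
    - move=> x y [x0 xi] [y0 yi]; split=> [|i i0 ik].
        by rewrite coefM big_ord1 /= x0 y0 mulr1.
      rewrite coefM big_ord_recl x0 yi ?subn0 // mulr0 add0r big1 // => l _.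
      by rewrite xi ?mul0r // (leq_trans _ ik) // lift0 ltn_ord.
    move=> n /andP[nt nk]; split=> [|i i0 ik]; first exact: S_poly_coef0.
    apply: S_poly_gap => //; move: nk; rewrite in_monics tm //= -ltnNge; lia.
  rewrite coefM big_ord_recr /= subnn u0 mulr1 big1 ?add0r // => i _.
  by rewrite ui ?mulr0 ?subn_gt0 ?leq_subr.
have ex : is_product_coef iota abs w k (product_coef iota abs w k).
  apply: (@xgetPex _ 0 (is_product_coef iota abs w k)).
  exists (\prod_(n <- monics k) S_poly iota abs n w)`_k.
  exists (monics k) => [n|t st tm]; first by rewrite in_monics => /andP[].
  exact: H.
have [u um hu] := ex; have tm n : n \in (u `|` monics k)%fset -> n \is monic.
  by rewrite inE in_monics => /orP[/um|/andP[]].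
rewrite -(hu (u `|` monics k)%fset) //; last by move=> n /= nu; rewrite inE nu.
by apply: H => // n nk; rewrite inE nk orbT.
Qed.

(** For n monic of degree d, the coefficient of T^(d-1) in a_i is that of 1/T in a_i / n. *)
Definition lead_vec d (a : V d) : {ffun 'I_m -> F} :=
  [ffun i => (a (widen_ord ms i) : {poly F})`_d.-1].

Definition const_vec (v : {ffun 'I_m -> F}) (i : 'I_s) : {poly F} :=
  if insub (i : nat) is Some j then (v j)%:P else 0.

Lemma size_const_vec v i : (size (const_vec v i) <= 1)%N.
Proof. by rewrite /const_vec; case: insub => [j|]; rewrite ?size_polyC_leq1 ?size_poly0. Qed.

Lemma const_vec_lt v (i : 'I_s) (im : (i < m)%N) : const_vec v i = (v (Ordinal im))%:P.
Proof. by rewrite /const_vec insubT. Qed.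

(** The division function at v / T, extended by zero: a representative of the class of all d_u with
    leading vector v. *)
Definition delta (v : {ffun 'I_m -> F}) : C := expL (fpt 'X (const_vec v)).

(** Since |a_i / T| = 1/q and |w_i| = q^K, the coordinate i makes the point attain the maximal
    absolute value q^(K-1). *)
Lemma abs_exp_max (a : 'I_s -> {poly F}) (i : 'I_s) :
  (forall i, (size (a i) <= 1)%N) -> (i < m)%N -> a i != 0 ->
  abs (expL (fpt 'X a)) = cmax.
Proof.
move=> a1 im ai; have X0 : 'X != 0 :> {poly F} by rewrite polyX_eq0.
have aX j : (size (a j) < size ('X : {poly F}))%N by rewrite size_polyX ltnS.
rewrite (abs_exp_frac_point hC qE ow wk aX kleK X0) /cmax; congr radial.
apply/eqP; rewrite eq_le (abs_frac_point_le hC qE ow wk aX kleK) /=.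
rewrite (abs_frac_point hC qE ow wk).
have -> : nrm 'X = q%:R by rewrite /nrm (negPf X0) size_polyX expr1.
rewrite ler_pM2r ?invr_gt0 ?(qR_gt0 qE) //; apply: le_trans (le_bigmax _ _ i).
rewrite (kK im) -[X in X <= _]mul1r ler_pM2r ?exprn_gt0 ?(qR_gt0 qE) //.
by rewrite -[1](expr0 q%:R) (nrm_size_gt qE) // size_poly_gt0.
Qed.

Lemma abs_delta v : v != 0 -> abs (delta v) = cmax.
Proof.
move=> v0; have [j vj] : exists j, v j != 0.
  apply: contrapT => h; move/negP: v0; apply; apply/eqP/ffunP => j; rewrite ffunE.
  by apply/eqP/negPn/negP => vj; apply: h; exists j.
apply: (@abs_exp_max _ (widen_ord ms j)); [exact: size_const_vec|exact: (ltn_ord j)|].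
rewrite (@const_vec_lt _ (widen_ord ms j) (ltn_ord j)) polyC_eq0.
by rewrite (_ : Ordinal _ = j) //; apply/val_inj.
Qed.

Lemma delta0 : delta 0 = 0.
Proof.
rewrite /delta /frac_point /lam big1 ?mul0r; last first.
  move=> i _; rewrite /const_vec; case: insub => [j|]; last by rewrite !rmorph0 mul0r.
  by rewrite ffunE !rmorph0 mul0r.
by rewrite /lattice_exp mul0r.
Qed.

Lemma abs_delta_le v : abs (delta v) <= cmax.
Proof.
have [->|/abs_delta -> //] := eqVneq v 0.
by rewrite delta0 (abs0 hC) ltW // cmax_gt0.
Qed.

Section Degree.
Variables (d : nat) (n : {poly F}).
Hypotheses (d0 : (0 < d)%N) (nm : n \is monic) (sn : size n = d.+1).

Let n0 : n != 0. Proof. exact: monic_neq0. Qed.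

Lemma abs_divf_le (a : V d) : abs (divf n a) <= cmax.
Proof.
apply: (abs_exp_frac_point_le hC qE ow wk) => // i.
by rewrite sn ltnS size_npoly.
Qed.

(* The two arguments of [expL] differ by an element of smaller absolute value
   than the maximal one [q ^ K / q]. *)
Lemma abs_divf_delta (a : V d) : abs (divf n a - delta (lead_vec a)) < cmax.
Proof.
have q0 := @qR_gt0 R _ _ qE.
have X0 : 'X != 0 :> {poly F} by rewrite polyX_eq0.
set v := lead_vec a.
have -> : divf n a - delta v =
    expL (fpt (n * 'X) (fun i => 'X * (a i : {poly F}) - n * const_vec v i)).
  rewrite /divf /delta -(lattice_expB hC qE ow wk); congr expL.
  rewrite /frac_point lamB !lamM !rmorphM /=.
  have pn0 : pa n != 0 by rewrite fmorph_eq0 tofrac_eq0.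
  have pX0 : pa 'X != 0 by rewrite fmorph_eq0 tofrac_eq0.
  by field; rewrite pn0 pX0.
have nX0 : n * 'X != 0 by rewrite mulf_neq0.
have snX : size (n * 'X) = d.+2 by rewrite size_mulX // sn.
have sXa i : (size ('X * (a i : {poly F}))%R <= d.+1)%N.
  rewrite mulrC; have [->|a0] := eqVneq (a i : {poly F}) 0; first by rewrite mul0r size_poly0.
  by rewrite size_mulX // ltnS size_npoly.
have snc i : (size (n * const_vec v i)%R <= d.+1)%N.
  apply: leq_trans (size_polyMleq _ _) _; rewrite sn addSn /=.
  by rewrite -[X in (_ <= X)%N]addn1 leq_add2l size_const_vec.
have sz i : (size ('X * (a i : {poly F}) - n * const_vec v i)%R <= d.+1)%N.
  by apply: leq_trans (size_polyD _ _) _; rewrite geq_max sXa size_polyN snc.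
(* For i < m the coefficients of T^d cancel, n being monic and v_i the coefficient of T^(d-1) in
   a_i. *)
have szm (i : 'I_s) : (i < m)%N -> (size ('X * (a i : {poly F}) - n * const_vec v i)%R <= d)%N.
  move=> im; apply/leq_sizeP => l; rewrite leq_eqVlt => /orP[/eqP <-|dl]; last first.
    by rewrite nth_default // (leq_trans (sz i)).
  rewrite coefB mulrC coefMX gtn_eqF // const_vec_lt coefMC ffunE.
  have -> : n`_d = 1 by have := monicP nm; rewrite lead_coefE sn.
  rewrite mul1r (_ : widen_ord _ _ = i) ?subrr //; exact/val_inj.
apply: (abs_exp_frac_point_lt hC qE ow wk) => [i|//|//|].
  by rewrite snX ltnS.
rewrite (abs_frac_point hC qE ow wk) ltr_pdivrMr ?nrm_gt0 //.
have -> : nrm (n * 'X) = q%:R * q%:R ^+ d by rewrite /nrm (negPf nX0) snX /= exprS.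
rewrite mulrA divfK ?gt_eqF //; apply: bigmax_lt => [|i _].
  by rewrite mulr_gt0 ?exprn_gt0.
have nrmle e (p : {poly F}) : (size p <= e.+1)%N -> nrm p <= q%:R ^+ e.
  move=> pe; rewrite /nrm; case: eqP => _; first by rewrite exprn_ge0 // ltW.
  by rewrite ler_eXn2l ?(qR_gt1 qE) //; lia.
rewrite mulrC; have [im|im] := ltnP i m.
  rewrite (kK im) ltr_pM2l ?exprn_gt0 //.
  apply: (@le_lt_trans _ _ (q%:R ^+ d.-1)); first by rewrite nrmle // prednK // szm.
  by rewrite ltr_eXn2l ?(qR_gt1 qE) // prednK.
(* For i >= m strictness comes from kappa i < K. *)
apply: (@le_lt_trans _ _ (q%:R ^+ kappa i * q%:R ^+ d)).
  by rewrite ler_wpM2l ?exprn_ge0 ?(ltW q0) // nrmle.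
by rewrite ltr_pM2r ?exprn_gt0 // ltr_eXn2l ?(qR_gt1 qE) // kltK.
Qed.

Lemma S_poly_cong :
  geom_cong abs cmax (S_poly iota abs n w) (\prod_(a : V d) (1 - delta (lead_vec a) *: 'X)).
Proof.
rewrite S_polyE sn /=; apply: (geom_cong_prod hC cmax_gt0) => a _.
apply: (geom_cong_1subZX hC cmax_gt0).
- exact: abs_divf_le.
- exact: abs_delta_le.
exact: abs_divf_delta.
Qed.

End Degree.

Definition Bpoly : {poly C} := \prod_v (1 - delta v *: 'X).

Let nzdelta := [seq delta v | v <- index_enum {ffun 'I_m -> F} & v != 0].

Lemma size_nzdelta : size nzdelta = (q ^ m).-1.
Proof.
rewrite size_map size_filter -sum1_count.
have : (\sum_(v : {ffun 'I_m -> F}) 1 = q ^ m)%N by rewrite sum1_card card_ffun card_ord qE.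
by rewrite (bigD1 (0 : {ffun 'I_m -> F})) //= => <-.
Qed.

Lemma BpolyE : Bpoly = \prod_(a <- nzdelta) (1 - a *: 'X).
Proof.
rewrite /Bpoly (bigD1 (0 : {ffun 'I_m -> F})) //= delta0 scale0r subr0 mul1r.
by rewrite big_map big_filter.
Qed.

Lemma size_Bpoly : (size Bpoly <= q ^ m)%N.
Proof.
have := size_prod_1subZX nzdelta; rewrite -BpolyE size_nzdelta prednK //.
exact: card_expn_gt0 qE m.
Qed.

Lemma Bpoly_coef0 : Bpoly`_0 = 1.
Proof.
rewrite -horner_coef0 horner_prod big1 // => v _.
by rewrite hornerD hornerN hornerZ hornerX hornerC mulr0 subr0.
Qed.

(** Up to sign, this coefficient is the product of the [delta v] over the nonzero v, all of absolute
    value [cmax]. *)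
Lemma abs_Bpoly_top : abs Bpoly`_(q ^ m).-1 = cmax ^+ (q ^ m).-1.
Proof.
rewrite BpolyE -size_nzdelta coef_prod_1subZX // subnn -horner_coef0 horner_prod.
rewrite (abs_prod hC) big_map big_filter.
rewrite (eq_bigr (fun=> cmax)); last first.
  by move=> v v0; rewrite hornerXsubC sub0r (absN hC) abs_delta.
by rewrite big_const_seq iter_mulr_1 size_map size_filter.
Qed.

(** The section [sec], which places v in degree d - 1, shows that all q^m fibres are translates of
    one another; together they have q^(sd) elements. *)
Lemma card_lead_vec d v : (0 < d)%N ->
  #|[pred a : V d | lead_vec a == v]| = (q ^ (s * d - m))%N.
Proof.
move=> d0; have q1 := q_gt1 qE.
have sz (u : {ffun 'I_m -> F}) i : (size (const_vec u i * 'X^(d.-1))%R <= d)%N.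
  apply: leq_trans (size_polyMleq _ _) _; rewrite size_polyXn prednK //.
  by rewrite -subn1 leq_subLR leq_add2r size_const_vec.
pose sec u : V d := [ffun i => NPoly (sz u i)].
have lead_sec u : lead_vec (sec u) = u.
  apply/ffunP => j; rewrite !ffunE /= coefMXn ltnn subnn.
  rewrite (@const_vec_lt _ (widen_ord ms j) (ltn_ord j)) coefC eqxx.
  by congr (u _); apply/val_inj.
have leadD (a b : V d) : lead_vec (a + b) = lead_vec a + lead_vec b.
  by apply/ffunP => j; rewrite !ffunE /= coefD.
have cst u : #|[pred a : V d | lead_vec a == u]| = #|[pred a : V d | lead_vec a == 0]|.
  rewrite -!sum1_card (reindex_inj (addIr (sec u))) /=; apply: eq_bigl => a.
  by rewrite !inE leadD lead_sec -subr_eq0 addrK.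
have tot : (q ^ (s * d) = q ^ m * #|[pred a : V d | lead_vec a == 0%R]|)%N.
  rewrite -(card_ffun_npoly s d qE) -sum1_card (partition_big (@lead_vec d) xpredT) //=.
  under eq_bigr => u _ do rewrite sum1_card cst.
  by rewrite sum_nat_const card_ffun card_ord qE.
rewrite cst; apply/eqP; rewrite -(eqn_pmul2l (m := q ^ m)) ?(card_expn_gt0 qE) //.
by rewrite -tot -expnD subnKC // (leq_trans ms) // leq_pmulr.
Qed.

Lemma prod_lead_vec d : (0 < d)%N ->
  \prod_(a : V d) (1 - delta (lead_vec a) *: 'X) = Bpoly ^+ (q ^ (s * d - m)).
Proof.
move=> d0; rewrite (partition_big (@lead_vec d) xpredT) //= -prodrXl.
apply: eq_bigr => v _; rewrite (eq_bigr (fun=> 1 - delta v *: 'X)).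
  by rewrite prodr_const -(card_lead_vec v d0).
by move=> a /eqP ->.
Qed.

Lemma prod_monics_succ M (f : {poly F} -> {poly C}) :
  \prod_(n <- monics M.+1 | n \notin monics M) f n =
  \prod_(p : {poly_M.+1 F}) f ('X^(M.+1) + (p : {poly F})).
Proof.
rewrite -big_filter -(big_map (fun p : {poly_M.+1 F} => 'X^(M.+1) + (p : {poly F})) xpredT f).
apply: perm_big; apply: uniq_perm.
- by rewrite filter_uniq ?fset_uniq.
- by rewrite map_inj_uniq ?index_enum_uniq // => p p' /addrI /val_inj.
move=> n; rewrite mem_filter !in_monics; apply/andP/mapP.
  move=> [h /andP[nm sn]]; have {h}sn : size n = M.+2.
    by move: h; rewrite nm /= -ltnNge => h; apply/eqP; rewrite eqn_leq sn h.
  have sp : (size (n - 'X^(M.+1))%R <= M.+1)%N.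
    apply/leq_sizeP => l; rewrite leq_eqVlt coefB coefXn => /orP[/eqP <-|Ml].
      by have := monicP nm; rewrite lead_coefE sn eqxx /= => ->; rewrite subrr.
    by rewrite gtn_eqF // subr0 nth_default // sn.
  by exists (NPoly sp); rewrite ?mem_index_enum //= addrC subrK.
move=> [p _ ->]; have sX : (size (p : {poly F}) < size ('X^(M.+1) : {poly F})%R)%N.
  by rewrite size_polyXn ltnS size_npoly.
have -> : 'X^(M.+1) + (p : {poly F}) \is monic.
  by rewrite monicE lead_coefDl // lead_coefXn.
by rewrite size_polyDl // size_polyXn !ltnSn -ltnNge leqnn.
Qed.

(** There are q^(M+1) monic n of degree M + 1, each with S_n congruent to B^(q^(s(M+1)-m)), which
    gives the exponent q^((s+1)(M+1)-m). *)
Lemma prod_monics_cong M : geom_cong abs cmax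
  (\prod_(n <- monics M) S_poly iota abs n w)
  (\prod_(d < M) Bpoly ^+ (q ^ (s.+1 * d.+1 - m))).
Proof.
elim: M => [|M IH].
  (* For M = 0 only n = 1 occurs, and S_1 = 1. *)
  rewrite big_ord0 big1_seq; first exact: (geom_cong1 hC cmax_gt0).
  move=> n /andP[_]; rewrite in_monics => /andP[nm sn].
  have n1 : (size n).-1 = 0%N by move: sn; case: (size n) => [|[]].
  have -> : S_poly iota abs n w = \prod_(a : V (size n).-1) 1.
    rewrite S_polyE; apply: eq_bigr => a _; suff -> : a = 0 by rewrite divf0 scale0r subr0.
    apply/ffunP => i; rewrite ffunE; apply/val_inj/eqP => /=.
    by rewrite -size_poly_leq0 (leq_trans (size_npoly _)) // n1.
  by rewrite big1.
have sub : {subset monics M <= monics M.+1}.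
  by move=> n; rewrite !in_monics => /andP[-> /= h]; exact: leqW.
rewrite (prod_split_fset _ sub) big_ord_recr /=; apply: (geom_congM hC cmax_gt0) => //.
rewrite prod_monics_succ.
have -> : (s.+1 * M.+1 - m = s * M.+1 - m + M.+1)%N by nia.
have -> : Bpoly ^+ (q ^ (s * M.+1 - m + M.+1)) =
    \prod_(p : {poly_M.+1 F}) Bpoly ^+ (q ^ (s * M.+1 - m)).
  by rewrite prodr_const card_npoly qE -exprM expnD.
apply: (geom_cong_prod hC cmax_gt0) => p _.
have sX : (size (p : {poly F}) < size ('X^(M.+1) : {poly F})%R)%N.
  by rewrite size_polyXn ltnS size_npoly.
rewrite -prod_lead_vec //; apply: S_poly_cong => //.
  by rewrite monicE lead_coefDl // lead_coefXn.
by rewrite size_polyDl // size_polyXn.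
Qed.

Lemma product_coef_bounded : geom_bounded abs cmax (product_coef iota abs w).
Proof.
move=> k; rewrite product_coefE.
by have [h _ _] := prod_monics_cong k; exact: h.
Qed.

Lemma abs_product_coef_eq k :
  sum_of_distinct_Q q s.+1 m.+1 k -> abs (product_coef iota abs w k) = cmax ^+ k.
Proof.
have q1 := q_gt1 qE.
have QE d : Qnum q s.+1 m.+1 d.+1 = ((q ^ m).-1 * q ^ (s.+1 * d.+1 - m))%N.
  rewrite /Qnum subn1 /= -{1}(@subnK m (s.+1 * d.+1)); last by nia.
  by rewrite expnD mulnC -subn1 mulnBl mul1n.
have qm1 : (0 < (q ^ m).-1)%N.
  by rewrite -subn1 subn_gt0 -{1}(expn0 q) ltn_exp2l.
have Q_lt d d' : (d < d')%N -> (Qnum q s.+1 m.+1 d.+1 < Qnum q s.+1 m.+1 d'.+1)%N.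
  by move=> dd'; rewrite !QE ltn_pmul2l // ltn_exp2l //; nia.
have Q_ge d : (d < Qnum q s.+1 m.+1 d.+1)%N.
  elim: d => [|d IH]; last exact: leq_ltn_trans IH (Q_lt _ _ (ltnSn d)).
  by rewrite QE muln_gt0 qm1 (card_expn_gt0 qE).
have Q_inj : injective (fun d => Qnum q s.+1 m.+1 d.+1).
  move=> d d' /= e; case: (ltngtP d d') => // /Q_lt; by rewrite e ltnn.
move=> [E [Eu EQ kE]].
pose D d := Qnum q s.+1 m.+1 d.+1 \in E.
(* Summing over d < k is enough, since d < Q_(d+1) <= k whenever Q_(d+1) occurs in E. *)
have kD : k = (\sum_(d < k) D d * ((q ^ m).-1 * q ^ (s.+1 * d.+1 - m)))%N.
  have pE : perm_eq E [seq Qnum q s.+1 m.+1 d.+1 | d <- index_iota 0 k & D d].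
    apply: uniq_perm => //.
      by rewrite map_inj_uniq ?filter_uniq ?iota_uniq.
    move=> x; apply/idP/mapP => [xE|[d]]; last by rewrite mem_filter => /andP[? _] ->.
    have [[|d] // _ xd] := EQ _ xE; exists d => //.
    rewrite mem_filter mem_index_iota /= /D -xd xE /=.
    apply: leq_trans (Q_ge d) _; rewrite -xd kE sumnE (big_rem x) //=; exact: leq_addr.
  rewrite {1}kE sumnE (perm_big _ pE) /= big_map big_filter big_mkcond /=.
  rewrite big_mkord; apply: eq_bigr => d _.
  by rewrite QE; case: (D d); rewrite ?mul1n ?mul0n.
have [_ _ h] := prod_monics_cong k; rewrite product_coefE.
have pk : abs (\prod_(d < k) Bpoly ^+ (q ^ (s.+1 * d.+1 - m)))`_k = cmax ^+ k.
  rewrite [in X in _`_X]kD.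
  rewrite (coef_prod_expr_card kap qE (leqW ms) size_Bpoly Bpoly_coef0) (abs_prod hC).
  rewrite [in X in _ ^+ X]kD -prodrXr; apply: eq_bigr => d _.
  case: (D d); last by rewrite (abs1 hC) mul0n expr0.
  by rewrite mul1n (absX hC) abs_Bpoly_top exprM.
(* The coefficient p_k differs by less than c^k from one of absolute value exactly c^k. *)
by rewrite -pk; apply: (abs_near hC); rewrite pk; exact: h.
Qed.

End ProductFunction.

(** * The domain F' and the final assembly *)

Lemma Fdom_abs (R : realType) (F : finFieldType) (C : closedFieldType)
    (iota : {rmorphism {fraction {poly F}} -> C}) (abs : C -> R) (s : nat)
    (k : 'I_s -> nat) (w : 'I_s -> C) (i : 'I_s) :
  is_Cinf iota abs -> Fdom iota abs k w -> abs (w i) = #|F|%:R ^+ k i.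
Proof.
move=> hC [[_ iw] _ hk].
have q1 : 1 < #|F|%:R :> R by rewrite ltr1n finNzRing_gt1.
have q0 : 0 < #|F|%:R :> R by apply: lt_trans q1.
(* As [ln 0] is 0 by convention, the logarithm alone does not exclude w_i = 0 when k_i = 0; linear
   independence does. *)
have wi0 : w i != 0.
  apply/negP => /eqP wi0.
  suff /eqP : iota (fracA (if i == i then 1 else 0 : {poly F})) = 0.
    by rewrite eqxx !rmorph1 oner_eq0.
  apply: (iw (fun l => iota (fracA (if l == i then 1 else 0 : {poly F})))).
    by move=> l; exact: (Kinf_pa hC).
  rewrite big1 // => l _; case: eqP => [->|_]; first by rewrite wi0 mulr0.
  by rewrite !rmorph0 mul0r.
have ln0 : ln #|F|%:R != 0 :> R by rewrite gt_eqF // ln_gt0.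
have := hk i; rewrite /logq => /(congr1 (fun x => x * ln #|F|%:R)).
rewrite divfK // => e.
by rewrite -[LHS]lnK ?posrE ?(abs_gt0 hC) // e mulrC expRM_natr lnK.
Qed.

(* [k i] is k_i for 1 <= i <= r, other values of [k] being irrelevant; the
   coordinate of index i : 'I_r.-1 of a point is omega_(i+2). *)
Theorem theorem6p11
    (R : realType) (F : finFieldType) (C : closedFieldType)
    (iota : {rmorphism {fraction {poly F}} -> C}) (abs : C -> R)
    (hC : is_Cinf iota abs)
    (r : nat) (hr : (2 <= r)%N)
    (k : nat -> nat)
    (hk : forall i, (1 <= i)%N -> (i < r)%N -> (k i.+1 <= k i)%N)
    (hkr : k r = 0%N)
    (j : nat) (hj : (2 <= j <= r)%N) (hkj : k j = k 2%N)
    (hjmax : forall i, (2 <= i <= r)%N -> k i = k 2%N -> (i <= j)%N) :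
  let q := #|F| in
  let F' := Fdom iota abs (fun i : 'I_r.-1 => k i.+2) in
  let P := fun w : 'I_r.-1 -> C => product_coef iota abs w in
  exists c : R,
    [/\ forall w, F' w -> abs (division_fun iota abs (@u0 F r.-1) w) = c,
        forall (m : nat) w, F' w ->
          abs (P w m) <= c ^+ m /\
          (sum_of_distinct_Q q r j m -> abs (P w m) = c ^+ m)
      & forall (m : nat) w, F' w ->
          abs (fps_exp (P w) ((q ^ r - 1) * (q - 1))%N m) <= c ^+ m /\
          abs (fps_exp (P w) (q ^ r - 1)%N m) <= c ^+ m].
Proof.
(* From here on r is s + 2 and the original j is j + 2: points have s + 1 coordinates, and exactly
   the first j + 1 have maximal absolute value, by maximality of the original j. *)
case: r hr hk hkr hj hjmax => [|[|s]] // _ hk _ hj hjmax q F' P.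
case: j hj hkj hjmax => [|[|j]] // hj hkj hjmax.
have mono a b : (1 <= a)%N -> (a <= b)%N -> (b <= s.+2)%N -> (k b <= k a)%N.
  move=> a1; elim: b => [|b IH]; first by rewrite leqn0 => /eqP ->.
  rewrite leq_eqVlt => /orP[/eqP -> //|ab] bs.
  by apply: leq_trans (IH ab (ltnW bs)); apply: hk => //; exact: leq_trans a1 ab.
pose kappa (i : 'I_s.+1) := k i.+2.
have kK (i : 'I_s.+1) : (i < j.+1)%N -> kappa i = k 2.
  move=> ij; apply/eqP; rewrite eqn_leq /kappa mono //=; last by rewrite !ltnS -ltnS.
  by rewrite -hkj mono.
have kltK (i : 'I_s.+1) : (j.+1 <= i)%N -> (kappa i < k 2)%N.
  move=> ij; rewrite ltn_neqAle /kappa mono ?andbT //; last by rewrite !ltnS -ltnS.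
  apply/negP => /eqP h; have : (i.+2 <= j.+2)%N.
    by apply: hjmax h; rewrite /= !ltnS -ltnS.
  by rewrite !ltnS leqNgt ij.
have js : (j.+1 <= s.+1)%N by case/andP: hj.
have q1 : #|F| = q by [].
exists (@cmax R F q s.+1 (k 2) kappa).
have F'w w : F' w -> Defs.orthogonal iota abs w /\ forall i, abs (w i) = q%:R ^+ kappa i.
  by move=> Fw; split=> [|i]; [case: Fw|rewrite (Fdom_abs i hC Fw)].
have c0 := @cmax_gt0 R F q q1 s.+1 (k 2) kappa.
have bd w : F' w -> geom_bounded abs (@cmax R F q s.+1 (k 2) kappa) (P w).
  move=> /F'w[ow wk].
  exact: (product_coef_bounded hC q1 (ltn0Sn s) (ltn0Sn j) js kK kltK ow wk).
split=> [w Fw|m w Fw|m w Fw].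
- have [ow wk] := F'w w Fw.
  (* The numerators of u_0 over the denominator T; the first coordinate makes [abs_exp_max]
     applicable. *)
  pose a (i : 'I_s.+1) : {poly F} := if i == 0%N :> nat then 1 else 0.
  have -> : @u0 F s.+1 = fun i => fracA (a i) / fracA 'X.
    apply/funext => i; rewrite /u0 /a; case: ifP => _.
      by rewrite rmorph1 mul1r.
    by rewrite rmorph0 mul0r.
  rewrite division_fun_frac.
  apply: (abs_exp_max hC q1 kK kltK ow wk (i := ord0)) => //.
    by move=> i; rewrite /a; case: ifP; rewrite ?size_poly1 ?size_poly0.
  by rewrite /a /= oner_eq0.
- have [ow wk] := F'w w Fw; split; first exact: bd.
  exact: (abs_product_coef_eq hC q1 (ltn0Sn s) (ltn0Sn j) js kK kltK ow wk).
(* Geometric bounds are stable under products, hence under powers. *)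
by split; apply: (geom_bounded_fps_exp hC c0); exact: bd.
Qed.
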